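(* Let $((A,\phi_{0}),(A^{*},X_{0}))$ be a Jacobi bialgebroid over a manifold $M$. For $i=1,2$ let $\pi_{i}\in\Gamma(\Lambda^{2}A)$ and $\omega_{i}\in\Gamma(\Lambda^{2}A^{*})$ satisfy the Maurer-Cartan type equations $$d_{A^{*},X_0}\pi_i+\tfrac12[\pi_i,\pi_i]_{A,\phi_0}=0,\qquad d_{A,\phi_0}\omega_i+\tfrac12[\omega_i,\omega_i]_{A^{*},X_0}=0 .$$ Let $(\tilde{A}_{\bar{\phi}_{0}},\tilde{A}^{*}_{\hat{X}_{0}})$ be the induced Lie bialgebroid over $M\times\mathbb{R}$, let $t$ be the standard coordinate on $\mathbb{R}$, and set $\tilde{\pi}_{i}:=e^{-t}\pi_{i}\in\Gamma(\Lambda^{2}\tilde{A})$ and $\tilde{\omega}_{i}:=e^{t}\omega_{i}\in\Gamma(\Lambda^{2}\tilde{A}^{*})$. Then: (i) $(\overline{\mathrm{graph}\,\tilde{\pi}_{1}^{\sharp}},\overline{\mathrm{graph}\,\tilde{\pi}_{2}^{\sharp}})$ is a Dirac pair on $(\tilde{A}_{\bar{\phi}_{0}},\tilde{A}^{*}_{\hat{X}_{0}})$ if and only if $(\overline{\mathrm{graph}\,\pi_{1}^{\sharp}},\overline{\mathrm{graph}\,\pi_{2}^{\sharp}})$ is a Dirac pair on $((A,\phi_{0}),(A^{*},X_{0}))$; (ii) $(\overline{\mathrm{graph}\,\tilde{\pi}_{1}^{\sharp}},\mathrm{graph}\,\tilde{\omega}_{2}^{\flat})$ is a Dirac pair on $(\tilde{A}_{\bar{\phi}_{0}},\tilde{A}^{*}_{\hat{X}_{0}})$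 if and only if $(\overline{\mathrm{graph}\,\pi_{1}^{\sharp}},\mathrm{graph}\,\omega_{2}^{\flat})$ is a Dirac pair on $((A,\phi_{0}),(A^{*},X_{0}))$; (iii) $(\mathrm{graph}\,\tilde{\omega}_{1}^{\flat},\mathrm{graph}\,\tilde{\omega}_{2}^{\flat})$ is a Dirac pair on $(\tilde{A}_{\bar{\phi}_{0}},\tilde{A}^{*}_{\hat{X}_{0}})$ if and only if $(\mathrm{graph}\,\omega_{1}^{\flat},\mathrm{graph}\,\omega_{2}^{\flat})$ is a Dirac pair on $((A,\phi_{0}),(A^{*},X_{0}))$.
   Context: Lie algebroids. A Lie algebroid over $M$ is a vector bundle $A\to M$ with a Lie bracket $[\cdot,\cdot]_A$ on $\Gamma(A)$ and a bundle map (anchor) $\rho_A:A\to TM$ with $[X,fY]_A=f[X,Y]_A+(\rho_A(X)f)Y$. The Schouten bracket $[\cdot,\cdot]_A:\Gamma(\Lambda^kA)\times\Gamma(\Lambda^lA)\to\Gamma(\Lambda^{k+l-1}A)$ is the unique extension of the Lie bracket with $[f,g]_A=0$, $[X,f]_A=\rho_A(X)f$, $[D_1,D_2\wedge D_3]_A=[D_1,D_2]_A\wedge D_3+(-1)^{(a_1+1)a_2}D_2\wedge[D_1,D_3]_A$, $[D_1,D_2]_A=-(-1)^{(a_1-1)(a_2-1)}[D_2,D_1]_A$ for $D_i\in\Gamma(\Lambda^{a_i}A)$. The differential $d_A:\Gamma(\Lambda^kA^* )\to\Gamma(\Lambda^{k+1}A^* )$ is $(d_A\omega)(X_0,\dots,X_k)=\sum_i(-1)^i\rho_A(X_i)(\omega(X_0,\dots,\hat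 X_i,\dots,X_k))+\sum_{i<j}(-1)^{i+j}\omega([X_i,X_j]_A,X_0,\dots,\hat X_i,\dots,\hat X_j,\dots,X_k)$. Elements of $\Gamma(\Lambda^2A)$ are called 2-sections on $A$, elements of $\Gamma(\Lambda^2A^* )$ 2-cosections. Jacobi algebroids. A Jacobi algebroid $(A,\phi_0)$ is a Lie algebroid $A$ with $\phi_0\in\Gamma(A^* )$, $d_A\phi_0=0$. For $D_i\in\Gamma(\Lambda^{a_i}A)$ put $[D_1,D_2]_{A,\phi_0}:=[D_1,D_2]_A+(a_1-1)D_1\wedge\iota_{\phi_0}D_2-(-1)^{a_1+1}(a_2-1)\iota_{\phi_0}D_1\wedge D_2$; put $d_{A,\phi_0}\omega:=d_A\omega+\phi_0\wedge\omega$ and $\mathcal{L}^{A,\phi_0}_X:=\iota_X d_{A,\phi_0}+d_{A,\phi_0}\iota_X$ on $\Gamma(\Lambda^*A^* )$, and $\mathcal{L}^{A,\phi_0}_XP:=[X,P]_{A,\phi_0}$ for $P\in\Gamma(\Lambda^*A)$. Jacobi bialgebroids. If $(A,\phi_0)$ and $(A^*,X_0)$ (so $X_0\in\Gamma(A)$) are Jacobi algebroids on dual vector bundles, $((A,\phi_0),(A^*,X_0))$ is a Jacobi bialgebroid if $d_{A^*,X_0}[X,Y]_A=[d_{A^*,X_0}X,Y]_{A,\phi_0}+[X,d_{A^*,X_0}Y]_{A,\phi_0}$ and $\mathcal{L}^{A,\phi_0}_{X_0}P+\mathcal{L}^{A^*,X_0}_{\phi_0}P=0$ for all $X,Y\in\Gamma(A)$,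 $P\in\Gamma(\Lambda^kA)$. Lie bialgebroids $(A,A^* )$ are exactly the Jacobi bialgebroids with $\phi_0=0$, $X_0=0$. Dirac structures. On $A\oplus A^*$ let $(X+\xi,Y+\eta)_\pm:=\frac12(\langle\xi,Y\rangle\pm\langle\eta,X\rangle)$ and $[\![X+\xi,Y+\eta]\!]:=\big([X,Y]_A+\mathcal{L}^{A^*,X_0}_\xi Y-\mathcal{L}^{A^*,X_0}_\eta X-d_{A^*,X_0}(X+\xi,Y+\eta)_-\big)+\big([\xi,\eta]_{A^*}+\mathcal{L}^{A,\phi_0}_X\eta-\mathcal{L}^{A,\phi_0}_Y\xi+d_{A,\phi_0}(X+\xi,Y+\eta)_-\big)$. A Dirac structure on $((A,\phi_0),(A^*,X_0))$ is a subbundle $L\subset A\oplus A^*$ maximally isotropic for $(\cdot,\cdot)_+$ with $\Gamma(L)$ closed under $[\![\cdot,\cdot]\!]$. A Dirac structure on a Lie bialgebroid is this notion with $\phi_0=0$, $X_0=0$. For $\pi\in\Gamma(\Lambda^2A)$, $\langle\pi^\sharp\xi,\eta\rangle:=\pi(\xi,\eta)$; for $\omega\in\Gamma(\Lambda^2A^* )$, $\langle\omega^\flat X,Y\rangle:=\omega(X,Y)$. Subsets of $A\oplus A^*$ are viewed as fibrewise relations in $A\times A^*$: $\overline{\mathrm{graph}\,\pi^\sharp}=\{(\pi^\sharp\xi,\xi)\mid\xi\in A^*\}$ and $\mathrm{graph}\,\omega^\flat=\{(X,\omega^\flat X)\mid X\in A\}$. Relations. For vector bundles $U,V$ over the same base,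 a relation $R\subset U\times V$ is understood fibrewise; its dual is, fibrewise, $R^*:=\{(\beta,\alpha)\in V^*\times U^*\mid \langle\alpha,u\rangle=\langle\beta,v\rangle\ \forall(u,v)\in R\}$; $\underline{R}$ is the set of pairs of sections $(X,Y)$ with $(X_p,Y_p)\in R$ for all points $p$. For a Lie algebroid $A$ and a relation $R\subset A\times A$, the Nijenhuis torsion is $\mathcal{T}_R((X_1,Y_1),(X_2,Y_2),(\alpha,\beta,\gamma)):=\langle\alpha,[Y_1,Y_2]_A\rangle-\langle\beta,[Y_1,X_2]_A+[X_1,Y_2]_A\rangle+\langle\gamma,[X_1,X_2]_A\rangle$, defined for $(X_i,Y_i)\in\underline{R}$ and sections $\alpha,\beta,\gamma$ of $A^*$ with $(\alpha,\beta)\in\underline{R^*}$ and $(\beta,\gamma)\in\underline{R^*}$. $R$ is Nijenhuis if $\mathcal{T}_R$ vanishes identically. Dirac pairs. For $L,L'\subset A\times A^*$ put $\mathrm{N}_{L,L'}:=\overline{L}*L'=\{(x,y)\in A\times A\mid\exists\alpha\in A^*:(x,\alpha)\in L',\ (y,\alpha)\in L\}$ (fibrewise). A pair $(L,L')$ of Dirac structures on a Jacobi (resp. Lie) bialgebroid is a Dirac pair on it if $\mathrm{N}_{L,L'}$ is a Nijenhuis relation for the Lie algebroid $A$. Induced Lie bialgebroid. Let $\tilde A:=A\times\mathbb{R}$, a vector bundle over $M\times\mathbb{R}$ whose sections are identified with time-dependent sections of $A$; operations of $A$ are applied to them pointwise in $t$. $\tilde A_{\bar\phi_0}$ is $\tilde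 A$ with the Lie algebroid structure $[\tilde X,\tilde Y\bar{]}_A^{\phi_0}:=[\tilde X,\tilde Y]_A+\langle\phi_0,\tilde X\rangle\frac{\partial\tilde Y}{\partial t}-\langle\phi_0,\tilde Y\rangle\frac{\partial\tilde X}{\partial t}$, $\bar\rho_A^{\phi_0}(\tilde X):=\rho_A(\tilde X)+\langle\phi_0,\tilde X\rangle\frac{\partial}{\partial t}$. $\tilde A^*_{\hat X_0}$ is $\tilde A^*=A^*\times\mathbb{R}$ with the Lie algebroid structure $[\tilde\xi,\tilde\eta\hat{]}_{A^*}^{X_0}:=e^{-t}\big([\tilde\xi,\tilde\eta]_{A^*}+\langle X_0,\tilde\xi\rangle(\frac{\partial\tilde\eta}{\partial t}-\tilde\eta)-\langle X_0,\tilde\eta\rangle(\frac{\partial\tilde\xi}{\partial t}-\tilde\xi)\big)$, $\hat\rho_{A^*}^{X_0}(\tilde\xi):=e^{-t}\big(\rho_{A^*}(\tilde\xi)+\langle X_0,\tilde\xi\rangle\frac{\partial}{\partial t}\big)$. It is known that $(\tilde A_{\bar\phi_0},\tilde A^*_{\hat X_0})$ is a Lie bialgebroid over $M\times\mathbb{R}$ whenever $((A,\phi_0),(A^*,X_0))$ is a Jacobi bialgebroid. *)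

(* Defs.v *)
From HB Require Import structures.
From mathcomp Require Import all_boot all_order all_algebra.
From mathcomp Require Import all_classical all_reals all_analysis.
From Stdlib Require List.

Set Implicit Arguments.
Unset Strict Implicit.
Unset Printing Implicit Defensive.

Import Order.TTheory GRing.Theory Num.Theory.
Import numFieldNormedType.Exports.

Local Open Scope classical_set_scope.
Local Open Scope ring_scope.

(* Manifolds, bundles and algebroids are split into raw data and a predicate
   carrying the axioms ([manifold], [vector_bundle], [lie_algebroid]).  Sections
   and operators on them are total functions; the axioms only constrain them on
   smooth arguments. *)

(** * Smooth manifolds *)

(* Class C^k, for [U] open: [f] is continuous on [U] and, if k > 0, its partial
   derivatives exist on [U] and are of class C^(k-1). *)
Fixpoint Ck_on (R : realType) (n k : nat) (U : set 'rV[R]_n)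
    (f : 'rV[R]_n -> R) : Prop :=
  (forall x, U x -> {for x, continuous f}) /\
  match k with
  | 0 => True
  | k'.+1 => forall i : 'I_n,
      (forall x, U x -> derivable f x (delta_mx 0 i)) /\
      Ck_on k' U (fun x => 'D_(delta_mx 0 i) f x)
  end.

Definition Cinf_on (R : realType) (n : nat) (U : set 'rV[R]_n)
    (f : 'rV[R]_n -> R) : Prop := forall k, Ck_on k U f.

(* [cmap] and [cinv] are total; only their restrictions to [cdom] and to its
   image are meaningful. *)
Record chart (R : realType) (M : Type) (n : nat) := Chart {
  cdom : set M;
  cmap : M -> 'rV[R]_n;
  cinv : 'rV[R]_n -> M }.

Definition manifold (R : realType) (M : topologicalType) (n : nat)
    (S : set (chart R M n)) : Prop :=
  [/\ hausdorff_space M /\ @second_countable M,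
      forall p, exists2 c, S c & cdom c p,
      forall c, S c ->
        [/\ open (cdom c), open (cmap c @` cdom c),
            forall p, cdom c p -> cinv c (cmap c p) = p,
            forall p, cdom c p -> {for p, continuous (cmap c)} &
            forall p, cdom c p -> {for cmap c p, continuous (cinv c)}] &
      forall c c', S c -> S c' -> forall j : 'I_n,
        Cinf_on (cmap c @` (cdom c `&` cdom c'))
          (fun x => cmap c' (cinv c x) 0 j)].

(* For [U] open in the manifold. *)
Definition smooth_on (R : realType) (M : Type) (n : nat)
    (S : set (chart R M n)) (U : set M) (f : M -> R) : Prop :=
  forall c, S c -> Cinf_on (cmap c @` (cdom c `&` U)) (f \o cinv c).

Definition smooth_fun (R : realType) (M : Type) (n : nat)
    (S : set (chart R M n)) (f : M -> R) : Prop := smooth_on S setT f.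

(* The product atlas of M * R. *)
Definition line_chart (R : realType) (M : Type) (n : nat) (c : chart R M n) :
    chart R (M * R) (n + 1) :=
  Chart [set q | cdom c q.1]
        (fun q => row_mx (cmap c q.1) (q.2%:M))
        (fun x => (cinv c (lsubmx x), rsubmx x 0 0)).

Definition line_atlas (R : realType) (M : Type) (n : nat)
    (S : set (chart R M n)) : set (chart R (M * R) (n + 1)) :=
  @line_chart R M n @` S.

(** * Vector bundles *)

(* A vector bundle is given by its fibres and by smooth local frames covering
   the base (equivalently, local trivialisations). *)
Record lframe (R : realType) (M : Type) (V : M -> vectType R) (r : nat) :=
  LFrame { fdom : set M; fvec : 'I_r -> forall p, V p }.

Record vbundle (R : realType) (M : Type) := VBundle {
  fib :> M -> vectType R;
  vrank : nat;
  frames : set (lframe fib vrank) }.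

Definition vsection (R : realType) (M : Type) (V : vbundle R M) : Type :=
  forall p : M, V p.

Definition frame_at (R : realType) (M : Type) (V : vbundle R M)
    (F : lframe V (vrank V)) (p : M) : (vrank V).-tuple (V p) :=
  [tuple fvec F j p | j < vrank V].

Definition smooth_section_on (R : realType) (M : Type) (n : nat)
    (S : set (chart R M n)) (V : vbundle R M) (U : set M)
    (X : vsection V) : Prop :=
  forall F, frames F -> forall j,
    smooth_on S (fdom F `&` U) (fun p => coord (frame_at F p) j (X p)).

Definition smooth_section (R : realType) (M : Type) (n : nat)
    (S : set (chart R M n)) (V : vbundle R M) (X : vsection V) : Prop :=
  smooth_section_on S setT X.

Definition vector_bundle (R : realType) (M : topologicalType) (n : nat)
    (S : set (chart R M n)) (V : vbundle R M) : Prop :=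
  [/\ forall p, exists2 F : lframe V (vrank V), frames F & fdom F p,
      forall F : lframe V (vrank V), frames F -> open (fdom F),
      forall F : lframe V (vrank V), frames F -> forall p, fdom F p ->
        basis_of fullv (frame_at F p) &
      forall F : lframe V (vrank V), frames F -> forall j,
        smooth_section_on S (fdom F) (fvec F j : vsection V)].

Definition dual_frame (R : realType) (M : Type) (V : vbundle R M)
    (F : lframe V (vrank V)) :
    lframe (fun p => 'Hom(V p, R^o) : vectType R) (vrank V) :=
  LFrame (fdom F)
    (fun j p => linfun (coord (frame_at F p) j : V p -> R^o)).

Definition dual (R : realType) (M : Type) (V : vbundle R M) : vbundle R M :=
  VBundle (@dual_frame R M V @` @frames R M V).

(* The bundle V * R over M * R.  A section of it is a time-dependent section of
   V, and the fibres of [dual (line V)] and [line (dual V)] are convertible. *)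
Definition line_frame (R : realType) (M : Type) (V : vbundle R M)
    (F : lframe V (vrank V)) :
    lframe (fun q : M * R => V q.1) (vrank V) :=
  LFrame [set q | fdom F q.1] (fun j q => fvec F j q.1).

Definition line (R : realType) (M : Type) (V : vbundle R M) :
    vbundle R (M * R) :=
  VBundle (@line_frame R M V @` @frames R M V).

(** * Sections of exterior powers *)

(* An element of Gamma(Lambda^k V^* ) is a field of alternating k-linear forms
   on the fibres of V; an element of Gamma(Lambda^k V) is one on the fibres of
   [dual V].  The arguments are kept in a sequence, and a k-form vanishes on
   sequences of length other than k, so that degrees need no casts. *)
Definition tensor (R : realType) (M : Type) (V : vbundle R M) : Type :=
  forall p : M, seq (V p) -> R.

Definition smooth_tensor (R : realType) (M : Type) (n : nat)
    (S : set (chart R M n)) (V : vbundle R M) (k : nat)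
    (w : tensor V) : Prop :=
  [/\ forall p s, size s != k -> w p s = 0,
      forall p s1 s2 c x y,
        w p (s1 ++ (c *: x + y) :: s2) =
        c * w p (s1 ++ x :: s2) + w p (s1 ++ y :: s2),
      forall p s1 s2 s3 x, w p (s1 ++ x :: s2 ++ x :: s3) = 0 &
      forall F, frames F -> forall js : seq 'I_(vrank V),
        smooth_on S (fdom F) (fun p => w p [seq fvec F j p | j <- js])].

(* Forms regarded as operators on sequences of sections. *)
Definition form (R : realType) (M : Type) (V : vbundle R M) : Type :=
  seq (vsection V) -> M -> R.

Definition op (R : realType) (M : Type) (V : vbundle R M) (w : tensor V) :
  form V := fun s p => w p [seq X p | X : vsection V <- s].

Definition form_eq (R : realType) (M : Type) (n : nat)
    (S : set (chart R M n)) (V : vbundle R M) (a b : form V) : Prop :=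
  forall s, List.Forall (fun X : vsection V => smooth_section S X) s ->
  a s =1 b s.

Definition is_form (R : realType) (M : Type) (n : nat)
    (S : set (chart R M n)) (V : vbundle R M) (k : nat) (a : form V) : Prop :=
  exists2 w : tensor V, smooth_tensor S k w & form_eq S a (op w).

Definition form0 (R : realType) (M : Type) (V : vbundle R M) : form V :=
  fun _ _ => 0.

Definition form_add (R : realType) (M : Type) (V : vbundle R M)
  (a b : form V) : form V := fun s p => a s p + b s p.

Definition form_scale (R : realType) (M : Type) (V : vbundle R M)
  (c : R) (a : form V) : form V := fun s p => c * a s p.

Definition form_sub (R : realType) (M : Type) (V : vbundle R M)
  (a b : form V) : form V := form_add a (form_scale (-1) b).

Definition of_fun (R : realType) (M : Type) (V : vbundle R M) (f : M -> R) :
  form V := fun s => if s is [::] then f else fun=> 0.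

Definition of_cosection (R : realType) (M : Type) (V : vbundle R M)
    (xi : vsection (dual V)) : form V :=
  fun s p => if s is [:: X] then xi p (X p) else 0.

Definition of_section (R : realType) (M : Type) (V : vbundle R M)
    (X : vsection V) : form (dual V) :=
  fun s p => if s is [:: xi] then (xi : vsection (dual V)) p (X p) else 0.

(* The interior product by [X]. *)
Definition iota_form (R : realType) (M : Type) (V : vbundle R M)
  (X : vsection V) (a : form V) : form V := fun s => a (X :: s).

(* The wedge product, determinant convention:
   (xi ^ eta)(X, Y) = xi(X) eta(Y) - xi(Y) eta(X).  The recursion is
   iota_X (a ^ b) = iota_X a ^ b + (-1)^|a| a ^ iota_X b. *)
Fixpoint wedge_rec (R : realType) (M : Type) (V : vbundle R M)
    (s : seq (vsection V)) (a b : form V) (p : M) : R :=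
  if s is X :: s' then
    wedge_rec s' (iota_form X a) b p +
    wedge_rec s' (fun u q => (-1) ^+ size u * a u q) (iota_form X b) p
  else a [::] p * b [::] p.

Definition wedge (R : realType) (M : Type) (V : vbundle R M)
  (a b : form V) : form V := fun s => wedge_rec s a b.

(** * Lie algebroids *)

(* Tangent vectors at p are derivations at p of the algebra of smooth functions
   on M, so the anchor maps V_p into the space of those. *)
Record algebroid (R : realType) (M : Type) (V : vbundle R M) := Algebroid {
  br : vsection V -> vsection V -> vsection V;
  anchor : forall p : M, V p -> (M -> R) -> R }.

Definition lieder (R : realType) (M : Type) (V : vbundle R M)
  (L : algebroid V) (X : vsection V) (f : M -> R) : M -> R :=
  fun p => anchor L (X p) f.

Definition bundle_map_to_tangent (R : realType) (M : Type) (n : nat)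
    (S : set (chart R M n)) (V : vbundle R M)
    (rho : forall p : M, V p -> (M -> R) -> R) : Prop :=
  [/\ forall p c (x y : V p) f, smooth_fun S f ->
        rho p (c *: x + y) f = c * rho p x f + rho p y f,
      forall p (x : V p) c f g, smooth_fun S f -> smooth_fun S g ->
        rho p x (fun q => c * f q + g q) = c * rho p x f + rho p x g,
      forall p (x : V p) f g, smooth_fun S f -> smooth_fun S g ->
        rho p x (fun q => f q * g q) = rho p x f * g p + f p * rho p x g &
      forall (X : vsection V) f, smooth_section S X -> smooth_fun S f ->
        smooth_fun S (fun p => rho p (X p) f)].

Definition lie_algebroid (R : realType) (M : Type) (n : nat)
    (S : set (chart R M n)) (V : vbundle R M) (L : algebroid V) : Prop :=
  bundle_map_to_tangent S (@anchor R M V L) /\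
  [/\ forall X Y, smooth_section S X -> smooth_section S Y ->
        smooth_section S (br L X Y),
      forall c X X' Y, smooth_section S X -> smooth_section S X' ->
        smooth_section S Y -> forall p,
        br L (fun q => c *: X q + X' q) Y p = c *: br L X Y p + br L X' Y p,
      forall X Y, smooth_section S X -> smooth_section S Y -> forall p,
        br L X Y p = - br L Y X p,
      forall X Y Z, smooth_section S X -> smooth_section S Y ->
        smooth_section S Z -> forall p,
        br L X (br L Y Z) p + br L Y (br L Z X) p + br L Z (br L X Y) p = 0 &
      forall X Y f, smooth_section S X -> smooth_section S Y ->
        smooth_fun S f -> forall p,
        br L X (fun q => f q *: Y q) p =
        f p *: br L X Y p + lieder L X f p *: Y p].

Definition rem_nth (T : Type) (i : nat) (s : seq T) : seq T :=
  take i s ++ drop i.+1 s.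

Definition sect (R : realType) (M : Type) (V : vbundle R M)
  (s : seq (vsection V)) (i : nat) : vsection V := nth (fun=> 0) s i.

(* The differential d_V on Gamma(Lambda^* V^* ). *)
Definition dform (R : realType) (M : Type) (V : vbundle R M)
    (L : algebroid V) (w : form V) : form V := fun s p =>
  \sum_(i < size s) (-1) ^+ i * lieder L (sect s i) (w (rem_nth i s)) p +
  \sum_(j < size s) \sum_(i < size s | (i < j)%N)
     (-1) ^+ (i + j) *
     w (br L (sect s i) (sect s j) :: rem_nth i (rem_nth j s)) p.

(* The Schouten bracket of the algebroid [L] on V acts on multisections of V.
   [W] is the bundle whose forms are these multisections and [emb] the
   inclusion of Gamma(V) in degree one: (V, W, emb) is either
   (A, dual A, of_section) or (dual A, A, of_cosection). *)
Definition is_schouten (R : realType) (M : Type) (n : nat)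
    (S : set (chart R M n)) (V W : vbundle R M)
    (emb : vsection V -> form W) (L : algebroid V)
    (sch : form W -> form W -> form W) : Prop :=
  [/\ forall D D' E E', form_eq S D D' -> form_eq S E E' ->
        form_eq S (sch D E) (sch D' E'),
      forall a b D E, is_form S a D -> is_form S b E -> (0 < a + b)%N ->
        is_form S (a + b).-1 (sch D E),
      forall a b c D D' E, is_form S a D -> is_form S a D' -> is_form S b E ->
        form_eq S (sch (form_add (form_scale c D) D') E)
          (form_add (form_scale c (sch D E)) (sch D' E)) &
      [/\ forall X Y, smooth_section S X -> smooth_section S Y ->
            form_eq S (sch (emb X) (emb Y)) (emb (br L X Y)),
          forall f g, smooth_fun S f -> smooth_fun S g ->
            form_eq S (sch (of_fun f) (of_fun g)) (@form0 R M W),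
          forall X f, smooth_section S X -> smooth_fun S f ->
            form_eq S (sch (emb X) (of_fun f)) (of_fun (lieder L X f)),
          forall a1 a2 a3 D1 D2 D3,
            is_form S a1 D1 -> is_form S a2 D2 -> is_form S a3 D3 ->
            form_eq S (sch D1 (wedge D2 D3))
              (form_add (wedge (sch D1 D2) D3)
                 (form_scale ((-1) ^+ (a1.+1 * a2)) (wedge D2 (sch D1 D3)))) &
          (* a_i - 1 is written a_i + 1, which has the same parity *)
          forall a1 a2 D1 D2, is_form S a1 D1 -> is_form S a2 D2 ->
            form_eq S (sch D1 D2)
              (form_scale (- (-1) ^+ (a1.+1 * a2.+1)) (sch D2 D1))]].

(* The unique (up to [form_eq]) such extension of the bracket of [L]. *)
Definition schouten (R : realType) (M : Type) (n : nat)
    (S : set (chart R M n)) (V W : vbundle R M)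
    (emb : vsection V -> form W) (L : algebroid V) :
    form W -> form W -> form W :=
  xget (fun _ _ _ _ => 0) [set sch | is_schouten S emb L sch].

(** * Jacobi algebroids and bialgebroids *)

(* d_{V,phi}, for a 1-form [phi] on V. *)
Definition dform_tw (R : realType) (M : Type) (V : vbundle R M)
    (L : algebroid V) (phi w : form V) : form V :=
  form_add (dform L w) (wedge phi w).

Definition lie_form_tw (R : realType) (M : Type) (V : vbundle R M)
    (L : algebroid V) (phi : form V) (X : vsection V) (w : form V) : form V :=
  form_add (iota_form X (dform_tw L phi w)) (dform_tw L phi (iota_form X w)).

(* [D1, D2]_{V,phi} in degrees a1, a2; [phi] is seen as a section of W. *)
Definition schouten_tw (R : realType) (M : Type) (n : nat)
    (S : set (chart R M n)) (V W : vbundle R M)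
    (emb : vsection V -> form W) (L : algebroid V) (phi : vsection W)
    (a1 a2 : nat) (D1 D2 : form W) : form W :=
  form_sub
    (form_add (schouten S emb L D1 D2)
       (form_scale (a1%:R - 1) (wedge D1 (iota_form phi D2))))
    (form_scale ((-1) ^+ a1.+1 * (a2%:R - 1)) (wedge (iota_form phi D1) D2)).

Section Pair.
Context {R : realType} {M : Type} {n : nat} (S : set (chart R M n)).
Context (A : vbundle R M).
(* Brackets on Gamma(Lambda^* A) and Gamma(Lambda^* A^* ). *)
Definition schA (L : algebroid A) (phi0 : vsection (dual A)) :=
  schouten_tw S (@of_section R M A) L phi0.
Definition schAs (Ls : algebroid (dual A)) (X0 : vsection A) :=
  schouten_tw S (@of_cosection R M A) Ls X0.

(* Differentials on Gamma(Lambda^* A^* ) and Gamma(Lambda^* A). *)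
Definition dA (L : algebroid A) (phi0 : vsection (dual A)) :=
  dform_tw L (of_cosection phi0).
Definition dAs (Ls : algebroid (dual A)) (X0 : vsection A) :=
  dform_tw Ls (of_section X0).

Definition lieA (L : algebroid A) (phi0 : vsection (dual A)) :=
  lie_form_tw L (of_cosection phi0).
Definition lieAs (Ls : algebroid (dual A)) (X0 : vsection A) :=
  lie_form_tw Ls (of_section X0).

Definition jacobi_bialgebroid (L : algebroid A) (Ls : algebroid (dual A))
    (phi0 : vsection (dual A)) (X0 : vsection A) : Prop :=
  [/\ [/\ lie_algebroid S L, smooth_section S phi0 &
          form_eq S (dform L (of_cosection phi0)) (@form0 R M A)],
      [/\ lie_algebroid S Ls, smooth_section S X0 &
          form_eq S (dform Ls (of_section X0)) (@form0 R M (dual A))],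
      forall X Y, smooth_section S X -> smooth_section S Y ->
        form_eq S (dAs Ls X0 (of_section (br L X Y)))
          (form_add
             (schA L phi0 2 1 (dAs Ls X0 (of_section X)) (of_section Y))
             (schA L phi0 1 2 (of_section X) (dAs Ls X0 (of_section Y)))) &
      forall k P, is_form S k P ->
        form_eq S (form_add (schA L phi0 1 k (of_section X0) P)
                            (lieAs Ls X0 phi0 P))
          (@form0 R M (dual A))].

Definition maurer_cartan (L : algebroid A) (Ls : algebroid (dual A))
    (phi0 : vsection (dual A)) (X0 : vsection A) (pi : tensor (dual A)) : Prop :=
  form_eq S (form_add (dAs Ls X0 (op pi))
               (form_scale 2^-1 (schA L phi0 2 2 (op pi) (op pi))))
    (@form0 R M (dual A)).

Definition co_maurer_cartan (L : algebroid A) (Ls : algebroid (dual A))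
    (phi0 : vsection (dual A)) (X0 : vsection A) (om : tensor A) : Prop :=
  form_eq S (form_add (dA L phi0 (op om))
               (form_scale 2^-1 (schAs Ls X0 2 2 (op om) (op om))))
    (@form0 R M A).

(** * The bracket on A + A^* *)

Definition pair_plus (p : M) (u v : A p * dual A p) : R :=
  2^-1 * (u.2 v.1 + v.2 u.1).
Definition pair_minus (p : M) (u v : A p * dual A p) : R :=
  2^-1 * (u.2 v.1 - v.2 u.1).

Definition minus_fun (X : vsection A) (xi : vsection (dual A))
    (Y : vsection A) (eta : vsection (dual A)) : M -> R :=
  fun p => pair_minus (X p, xi p) (Y p, eta p).

(* The components of [[X + xi, Y + eta]] in Gamma(A), as a 1-form on A^*, and in
   Gamma(A^* ), as a 1-form on A. *)
Definition courant_A (L : algebroid A) (Ls : algebroid (dual A))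
    (X0 : vsection A) (X : vsection A) (xi : vsection (dual A))
    (Y : vsection A) (eta : vsection (dual A)) : form (dual A) :=
  form_sub
    (form_sub
       (form_add (of_section (br L X Y)) (lieAs Ls X0 xi (of_section Y)))
       (lieAs Ls X0 eta (of_section X)))
    (dAs Ls X0 (of_fun (minus_fun X xi Y eta))).

Definition courant_As (L : algebroid A) (Ls : algebroid (dual A))
    (phi0 : vsection (dual A)) (X : vsection A) (xi : vsection (dual A))
    (Y : vsection A) (eta : vsection (dual A)) : form A :=
  form_add
    (form_sub
       (form_add (of_cosection (br Ls xi eta)) (lieA L phi0 X (of_cosection eta)))
       (lieA L phi0 Y (of_cosection xi)))
    (dA L phi0 (of_fun (minus_fun X xi Y eta))).

(* Z + zeta = [[X + xi, Y + eta]].  A section is determined by its pairings with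
   all smooth sections of the dual bundle, and is smooth when they are. *)
Definition is_courant (L : algebroid A) (Ls : algebroid (dual A))
    (phi0 : vsection (dual A)) (X0 : vsection A)
    (X : vsection A) (xi : vsection (dual A))
    (Y : vsection A) (eta : vsection (dual A))
    (Z : vsection A) (zeta : vsection (dual A)) : Prop :=
  (forall b : vsection (dual A), smooth_section S b ->
     forall p, b p (Z p) = courant_A L Ls X0 X xi Y eta [:: b] p) /\
  (forall B : vsection A, smooth_section S B ->
     forall p, zeta p (B p) = courant_As L Ls phi0 X xi Y eta [:: B] p).

(** * Relations *)

Definition NLL (L L' : forall p, A p -> dual A p -> Prop) :
    forall p, A p -> A p -> Prop :=
  fun p x y => exists2 a : dual A p, L' p x a & L p y a.

(* {(b, a) | <a, u> = <b, v> for all (u, v) in N} *)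
Definition dual_rel (N : forall p, A p -> A p -> Prop) :
    forall p, dual A p -> dual A p -> Prop :=
  fun p b a => forall u v, N p u v -> a u = b v.

Definition nijenhuis (L : algebroid A)
    (N : forall p, A p -> A p -> Prop) : Prop :=
  forall (X1 Y1 X2 Y2 : vsection A) (a b c : vsection (dual A)),
    smooth_section S X1 -> smooth_section S Y1 ->
    smooth_section S X2 -> smooth_section S Y2 ->
    smooth_section S a -> smooth_section S b -> smooth_section S c ->
    (forall p, N p (X1 p) (Y1 p)) -> (forall p, N p (X2 p) (Y2 p)) ->
    (forall p, dual_rel N (a p) (b p)) -> (forall p, dual_rel N (b p) (c p)) ->
    forall p,
      a p (br L Y1 Y2 p) - b p (br L Y1 X2 p + br L X1 Y2 p) +
      c p (br L X1 X2 p) = 0.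

(* The reversed graph of pi^sharp, {(pi^sharp xi, xi)}, and the graph of
   om^flat; pi^sharp xi is defined by <pi^sharp xi, eta> = pi(xi, eta). *)
Definition graph_sharp (pi : tensor (dual A)) :
    forall p, A p -> dual A p -> Prop :=
  fun p x xi => forall eta : dual A p, eta x = pi p [:: xi; eta].

Definition graph_flat (om : tensor A) : forall p, A p -> dual A p -> Prop :=
  fun p x xi => forall y : A p, xi y = om p [:: x; y].

End Pair.

(** * Dirac structures and Dirac pairs *)

Section Dirac.
Context {R : realType} {M : topologicalType} {n : nat}.
Context (S : set (chart R M n)) (A : vbundle R M).
Context (L : algebroid A) (Ls : algebroid (dual A)).

(* Near every point, D is spanned by independent smooth local sections. *)
Definition subbundle (D : forall p, A p -> dual A p -> Prop) : Prop :=
  forall p, exists (U : set M) (k : nat) (X : 'I_k -> vsection A)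
      (xi : 'I_k -> vsection (dual A)),
    [/\ open U, U p,
        forall j, smooth_section_on S U (X j) /\ smooth_section_on S U (xi j) &
        forall q, U q ->
          free [tuple ((X j q, xi j q) : (A q * dual A q)%type) | j < k] /\
          forall x a, D q x a <->
            ((x, a) : (A q * dual A q)%type) \in
              <<[tuple ((X j q, xi j q) : (A q * dual A q)%type) | j < k]>>%VS].

Definition isotropic (p : M) (W : {vspace (A p * dual A p)%type}) : Prop :=
  forall u v, u \in W -> v \in W -> pair_plus u v = 0.

Definition maximally_isotropic (D : forall p, A p -> dual A p -> Prop) : Prop :=
  forall p, exists W : {vspace (A p * dual A p)%type},
    [/\ forall x a, D p x a <-> (x, a) \in W,
        isotropic W &
        forall W' : {vspace (A p * dual A p)%type},
          isotropic W' -> (W <= W')%VS -> W' = W].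

Definition dirac (phi0 : vsection (dual A)) (X0 : vsection A)
    (D : forall p, A p -> dual A p -> Prop) : Prop :=
  [/\ subbundle D, maximally_isotropic D &
      forall (X : vsection A) (xi : vsection (dual A))
             (Y : vsection A) (eta : vsection (dual A)),
        smooth_section S X -> smooth_section S xi ->
        smooth_section S Y -> smooth_section S eta ->
        (forall p, D p (X p) (xi p)) -> (forall p, D p (Y p) (eta p)) ->
        exists (Z : vsection A) (zeta : vsection (dual A)),
          is_courant S L Ls phi0 X0 X xi Y eta Z zeta /\
          forall p, D p (Z p) (zeta p)].

Definition dirac_pair (phi0 : vsection (dual A)) (X0 : vsection A)
    (D D' : forall p, A p -> dual A p -> Prop) : Prop :=
  [/\ dirac phi0 X0 D, dirac phi0 X0 D' & nijenhuis S L (NLL D D')].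

Definition lie_dirac_pair (D D' : forall p, A p -> dual A p -> Prop) : Prop :=
  dirac_pair (fun=> 0) (fun=> 0) D D'.

End Dirac.

(** * The induced Lie bialgebroid over M * R *)

(* The derivative of a curve in a finite-dimensional space, coordinatewise in
   some basis. *)
Definition curve_derive (R : realType) (U : vectType R) (g : R -> U) (t : R) :
    U :=
  \sum_(j < \dim (fullv : {vspace U}))
    derive1 (fun s => coord (vbasis fullv) j (g s) : R) t *: (vbasis fullv)`_j.

Section Induced.
Context {R : realType} {M : Type} (A : vbundle R M).

Definition slice (V : vbundle R M) (t : R) (X : vsection (line V)) :
  vsection V := fun p => X (p, t).

Definition dt (V : vbundle R M) (X : vsection (line V)) : vsection (line V) :=
  fun q => curve_derive (fun s => X (q.1, s) : V q.1) q.2.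

Definition bar_algebroid (L : algebroid A) (phi0 : vsection (dual A)) :
    algebroid (line A) :=
  @Algebroid R (M * R)%type (line A)
    (fun X Y q =>
       br L (slice q.2 X) (slice q.2 Y) q.1
       + phi0 q.1 (X q) *: dt Y q - phi0 q.1 (Y q) *: dt X q)
    (fun q x f =>
       anchor L x (fun p => f (p, q.2))
       + phi0 q.1 x * derive1 (fun s => f (q.1, s)) q.2).

Definition hat_algebroid (Ls : algebroid (dual A)) (X0 : vsection A) :
    algebroid (dual (line A)) :=
  @Algebroid R (M * R)%type (dual (line A))
    (fun (xi eta : vsection (line (dual A))) q =>
       expR (- q.2) *:
       (br Ls (slice q.2 xi) (slice q.2 eta) q.1
        + (xi q (X0 q.1) : R) *: (dt eta q - eta q)
        - (eta q (X0 q.1) : R) *: (dt xi q - xi q)))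
    (fun q (a : dual A q.1) f =>
       expR (- q.2) *
       (anchor Ls a (fun p => f (p, q.2))
        + a (X0 q.1) * derive1 (fun s => f (q.1, s)) q.2)).

(* e^{-t} pi and e^t om. *)
Definition tilde_pi (pi : tensor (dual A)) : tensor (dual (line A)) :=
  fun q s => expR (- q.2) * pi q.1 s.

Definition tilde_om (om : tensor A) : tensor (line A) :=
  fun q s => expR q.2 * om q.1 s.

End Induced.

(* Main.v *)
From HB Require Import structures.
Require Import Defs.
From mathcomp Require Import all_boot all_order all_algebra.
From mathcomp Require Import all_classical all_reals all_analysis ring.

(** Let D be a field of subspaces of A + A^* over M, and let D~ be the field over
M * R whose fibre at (p, t) is {(e^(-t) x, a) | (x, a) in D_p} ([line_rel]).  The
bundles D~ attached to the graphs of pi and of omega are the graphs of e^(-t) pi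
and of e^t omega ([graph_sharp_line], [graph_flat_line]), so all three claims are
instances of one: (D, D') is a Dirac pair if and only if (D~, D'~) is one
([dirac_pair_line]).  Time-dependent sections go to sections over M by freezing the
time, X |-> e^t X(., t); sections over M come back as X |-> e^(-t) X, and nothing
is lost when the result is looked at in t = 0.

The isotropy conditions and local spanning sections are carried across by the
linear automorphism (x, a) |-> (e^(-t) x, a) of the fibre.  For the bracket, write
two time-dependent sections of D~ as e1 = (e^(-t) X, xi) and e2 = (e^(-t) Y, eta),
with (X, xi) and (Y, eta) in D at all times.  Expanding the definitions gives

  e^(2t) Z~  = Z    + v (Y' - Y)     - w (X' - X),
  e^t  zeta~ = zeta + v (eta' - eta) - w (xi' - xi),

where (Z~, zeta~) is the bracket
over M * R, (Z, zeta) is the one over M at the frozen time, the prime is d/dt,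
v = <phi0, X> + <xi, X0> and w = <phi0, Y> + <eta, X0> ([courant_drift]).  The
terms along X0 and phi0 that also appear have the coefficient
<xi', Y> + <eta, X'> - <eta', X> - <xi, Y'> over 2, which vanishes by isotropy.
Since D_p is a fixed subspace, the derivative of a curve in D_p stays in D_p
([line_rel_time_derive]), hence the correction is a section of D ([drift_rel]), and
one bracket is in D~ exactly when the other is in D.

For the torsion of N = N_{D,D'} the same happens: over M * R it is e^(-2t) times
the torsion at the frozen time, plus terms of the form <a, Y'> - <b, X'> with
(X, Y) in N and (a, b) in the dual relation.  These vanish, because
<a, Y> - <b, X> vanishes along the whole curve ([dual_rel_time_derive],
[torsion_line], [nijenhuis_line]).

The anchor and the bracket are linear on smooth arguments only, and d/dt needs
differentiability; this is why smoothness is followed through slices, lifts and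
pairings first. *)

Set Implicit Arguments.
Unset Strict Implicit.
Unset Printing Implicit Defensive.

Import Order.TTheory GRing.Theory Num.Theory.
Import numFieldNormedType.Exports.

Local Open Scope classical_set_scope.
Local Open Scope ring_scope.

(** * Calculus of functions of class C^k *)

Section Calculus.
Context {R : realType}.

(** The two difference quotients are the same function of h. *)
Lemma derive_affine (V W : normedModType R) (f : W -> R) (g : V -> W) x v w :
  (forall h : R, g (h *: v + x) = h *: w + g x) ->
  'D_v (f \o g) x = 'D_w f (g x) /\
  (derivable f (g x) w -> derivable (f \o g) x v).
Proof.
move=> gE; have E : (fun h => h^-1 *: (((f \o g) \o shift x) (h *: v) - (f \o g) x))
    = (fun h => h^-1 *: ((f \o shift (g x)) (h *: w) - f (g x))).
  by apply/funext => h /=; rewrite gE.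
by rewrite /derive /derivable E.
Qed.

Lemma derivable_dir0 (V : normedModType R) (f : V -> R) x :
  derivable f x 0 /\ 'D_0 f x = 0.
Proof.
have E : (fun h : R => h^-1 *: ((f \o shift x) (h *: 0) - f x)) = fun=> 0.
  by apply/funext => h /=; rewrite scaler0 add0r subrr scaler0.
rewrite /derivable /derive E; split; first exact: is_cvg_cst.
exact: lim_cst.
Qed.

Lemma Ck_on_continuous n k (U : set 'rV[R]_n) f x :
  Ck_on k U f -> U x -> {for x, continuous f}.
Proof. by case: k => [|k] [+ _] Ux; apply. Qed.

(** [Ck_on] is a condition at each point, since ['D_v f] is a total function;
    hence the sets V need not be open. *)
Lemma Ck_on_cover n k (U : set 'rV[R]_n) (f : 'rV[R]_n -> R) :
  (forall x, U x -> exists2 V, V x & Ck_on k V f) -> Ck_on k U f.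
Proof.
elim: k f => [|k IH] f H.
  by split=> // x /H[V Vx /Ck_on_continuous]; apply.
split=> [x /H[V Vx /Ck_on_continuous]|i]; first by apply.
split=> [x /H[V Vx [_ /(_ i) [+ _]]]|]; first by apply.
by apply: IH => x /H[V Vx [_ /(_ i) [_ ?]]]; exists V.
Qed.

Lemma Ck_on_sub n k (U V : set 'rV[R]_n) (f : 'rV[R]_n -> R) :
  V `<=` U -> Ck_on k U f -> Ck_on k V f.
Proof.
by move=> VU Uf; apply: Ck_on_cover => x Vx; exists U => //; exact: VU.
Qed.

Lemma Ck_onW n k (U : set 'rV[R]_n) (f : 'rV[R]_n -> R) :
  Ck_on k.+1 U f -> Ck_on k U f.
Proof.
elim: k f => [|k IH] f [cf H]; split => // i; have [df Df] := H i.
by split=> //; exact: IH.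
Qed.

(** Openness makes f and g equal near each point, so that their derivatives agree
    on U as well and the induction on k applies to them. *)
Lemma Ck_on_eq n k (U : set 'rV[R]_n) (f g : 'rV[R]_n -> R) :
  open U -> (forall x, U x -> f x = g x) -> Ck_on k U f -> Ck_on k U g.
Proof.
move=> oU; elim: k f g => [|k IH] f g fg [cf H].
all: have nfg x : U x -> \forall y \near x, f y = g y
  by move=> Ux; have := open_nbhs_nbhs (conj oU Ux); exact: filterS.
all: have cg x : U x -> {for x, continuous g}.
1, 3: move=> Ux; have := cf x Ux; rewrite /prop_for /continuous_at fg//.
1, 2: by apply: cvg_trans; exact: (near_eq_cvg (nfg x Ux)).
- by split.
- split=> // i; have [df Df] := H i; split.
    by move=> x Ux; apply: near_eq_derivable (df x Ux); exact: nfg.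
  apply: IH Df => x Ux; apply: near_eq_derive; exact: nfg.
Qed.

Lemma Ck_on_cst n k (U : set 'rV[R]_n) (c : R) : Ck_on k U (fun=> c).
Proof.
elim: k c => [|k IH] c.
  by split=> // x _; exact: cst_continuous.
split=> [x _|i]; first exact: cst_continuous.
split=> [x _|]; first exact: derivable_cst.
have -> : (fun x : 'rV[R]_n => 'D_(delta_mx 0 i) (fun=> c) x) = (fun=> 0).
  by apply: funext => x; exact: derive_cst.
exact: IH.
Qed.

Lemma Ck_onD n k (U : set 'rV[R]_n) (f g : 'rV[R]_n -> R) : open U ->
  Ck_on k U f -> Ck_on k U g -> Ck_on k U (fun x => f x + g x).
Proof.
move=> oU; elim: k f g => [|k IH] f g [cf Hf] [cg Hg].
  by split=> // x Ux; apply: continuousD; [exact: cf|exact: cg].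
split=> [x Ux|i].
  by apply: continuousD; [exact: cf|exact: cg].
have [df Df] := Hf i; have [dg Dg] := Hg i; split=> [x Ux|].
  by apply: derivableD; [exact: df|exact: dg].
apply: Ck_on_eq oU _ (IH _ _ Df Dg) => x Ux /=.
by rewrite -deriveD//; [exact: df|exact: dg].
Qed.

Lemma Ck_onM n k (U : set 'rV[R]_n) (f g : 'rV[R]_n -> R) : open U ->
  Ck_on k U f -> Ck_on k U g -> Ck_on k U (fun x => f x * g x).
Proof.
move=> oU; elim: k f g => [|k IH] f g.
  move=> [cf _] [cg _]; split=> // x Ux.
  by apply: continuousM; [exact: cf|exact: cg].
move=> Hf0 Hg0; have fk := Ck_onW Hf0; have gk := Ck_onW Hg0.
move: Hf0 Hg0 => [cf Hf] [cg Hg].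
split=> [x Ux|i].
  by apply: continuousM; [exact: cf|exact: cg].
have [df Df] := Hf i; have [dg Dg] := Hg i; split=> [x Ux|].
  by apply: derivableM; [exact: df|exact: dg].
apply: Ck_on_eq oU _ (Ck_onD oU (IH _ _ fk Dg) (IH _ _ gk Df)) => x Ux /=.
by rewrite deriveM//; [exact: df|exact: dg].
Qed.

(** A partial derivative of f o g is a partial derivative of f composed with g, or
    zero: the common reason why slices, projections and functions of a single
    coordinate are smooth. *)
Lemma Ck_on_affine m n k (g : 'rV[R]_m -> 'rV[R]_n)
    (U : set 'rV[R]_n) (V : set 'rV[R]_m) (f : 'rV[R]_n -> R) :
  continuous g ->
  (forall i, exists2 w, w = 0 \/ exists j, w = delta_mx 0 j &
     forall x (h : R), g (h *: delta_mx 0 i + x) = h *: w + g x) ->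
  (forall x, V x -> U (g x)) -> Ck_on k U f -> Ck_on k V (f \o g).
Proof.
move=> cg gE VU; elim: k f => [|k IH] f [cf Hf].
  by split=> // x Vx; apply: continuous_comp; [exact: cg|exact/cf/VU].
split=> [x Vx|i].
  by apply: continuous_comp; [exact: cg|exact/cf/VU].
have [w wE gw] := gE i; split=> [x Vx|].
  apply: (derive_affine f (gw x)).2.
  case: wE => [->|[j ->]]; first exact: (derivable_dir0 f _).1.
  by have [df _] := Hf j; exact/df/VU.
have -> : (fun x : 'rV[R]_m => 'D_(delta_mx 0 i) (f \o g) x) = (fun x : 'rV[R]_n => 'D_w f x) \o g.
  by apply: funext => x; exact: (derive_affine f (gw x)).1.
case: wE => [->|[j ->]]; last by have [_ Df] := Hf j; exact: IH.
have -> : (fun x : 'rV[R]_n => 'D_0 f x) \o g = fun=> 0.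
  by apply: funext => x; exact: (derivable_dir0 f _).2.
exact: Ck_on_cst.
Qed.

Lemma Ck_on_slice n k (U : set 'rV[R]_(n + 1)) (V : set 'rV[R]_n) f (t : R) :
  (forall x, V x -> U (row_mx x t%:M)) -> Ck_on k U f ->
  Ck_on k V (fun x => f (row_mx x t%:M)).
Proof.
move=> VU; apply: Ck_on_affine VU => [|i].
  move=> u B /nbhs_ballP[e /= e0 eB]; apply/nbhs_ballP; exists e => //= v [_ uv].
  apply: eB; split=> // a b; rewrite !mxE; case: (fintype.split b) => l; first exact: uv.
  exact: ballxx.
exists (row_mx (delta_mx 0 i) 0).
  right; exists (lshift 1 i); apply/matrixP => a b; rewrite !mxE.
  by case: splitP => l bl; rewrite !mxE -!val_eqE/= bl //
    (gtn_eqF (ltn_addr _ (ltn_ord i))) andbF.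
move=> x h; rewrite scale_row_mx scaler0 add_row_mx add0r; congr row_mx.
Qed.

Lemma Ck_on_lsubmx n k (U : set 'rV[R]_n) (V : set 'rV[R]_(n + 1)) f :
  (forall x, V x -> U (lsubmx x)) -> Ck_on k U f -> Ck_on k V (f \o lsubmx).
Proof.
move=> VU; apply: Ck_on_affine VU => [|i]; first exact: continuous_lsubmx.
exists (lsubmx (delta_mx 0 i)); last by move=> x h; rewrite linearD linearZ.
case: (splitP i) => l il; last first.
  left; apply/matrixP => a b; rewrite !mxE.
  by rewrite -!val_eqE (il : val i = _) /= (ltn_eqF (ltn_addr _ (ltn_ord b))) andbF.
right; exists l; apply/matrixP => a b; rewrite !mxE.
by rewrite -!val_eqE (il : val i = _) /=.
Qed.

Lemma Ck_on_exp n k (U : set 'rV[R]_(n + 1)) :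
  Ck_on k U (fun x => expR (- (rsubmx x 0 0))).
Proof.
pose f := fun y : 'rV[R]_1 => expR (- y 0 0).
suff fk : Ck_on k setT f.
  apply: (@Ck_on_affine _ _ _ rsubmx setT U f) => // [|i].
    exact: continuous_rsubmx.
  exists (rsubmx (delta_mx 0 i)); last by move=> x h; rewrite linearD linearZ.
  case: (splitP i) => l il.
    left; apply/matrixP => a b; rewrite !mxE.
    by rewrite -!val_eqE (il : val i = _) /= (gtn_eqF (ltn_addr _ (ltn_ord l))) andbF.
  right; exists l; apply/matrixP => a b; rewrite !mxE.
  by rewrite -!val_eqE (il : val i = _) /= eqn_add2l.
have dE (y : 'rV[R]_1) (i : 'I_1) :
    is_derive y (delta_mx 0 i) f (- f y).
  have E (h : R) : (h *: delta_mx 0 i + y) 0 0 = h *: 1 + y 0 0.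
    by rewrite !mxE (ord1 i) eqxx.
  pose g (s : R) := expR (- s).
  have [fE fd] := @derive_affine 'rV[R]_1 R g (fun y => y 0 0) y _ 1 E.
  have : is_derive (y 0 0 : R) 1 g (- g (y 0 0)).
    rewrite /g; have := is_derive1_comp (f := expR) (g := -%R)
      (is_derive_expR (- y 0 0)) (is_deriveN (is_derive_id (y 0 0) 1)).
    by rewrite mulrN1.
  move=> [gd gE]; split; first exact: fd.
  by rewrite [LHS]fE gE.
have cf : continuous f.
  move=> y; apply: (@continuous_comp _ _ _ (fun y : 'rV[R]_1 => - y 0 0)).
    by apply: continuousN; exact: coord_continuous.
  exact: continuous_expR.
have NE : (fun y => - f y) = (fun y => -1 * f y).
  by apply: funext => y; rewrite mulN1r.
elim: k => [|k IH]; first by split=> // x _; exact: cf.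
split=> [x _|i]; first exact: cf.
split=> [y _|]; first by have [] := dE y i.
have -> : (fun x : 'rV[R]_1 => 'D_(delta_mx 0 i) f x) = (fun y => - f y).
  by apply: funext => y; have [_ ->] := dE y i.
by rewrite NE; apply: Ck_onM => //; [exact: openT|exact: Ck_on_cst].
Qed.

End Calculus.

(** * Smooth functions on M and on M * R *)

Section SmoothFunctions.
Context {R : realType} {M : topologicalType} {n : nat} (S : set (chart R M n)).

Lemma smooth_on_cover (U : set M) (f : M -> R) :
  (forall p, U p -> exists2 V, V p & smooth_on S V f) -> smooth_on S U f.
Proof.
move=> H c Sc k; apply: Ck_on_cover => _ [p [cp Up] <-].
have [V Vp Vf] := H p Up; exists (cmap c @` (cdom c `&` V)); last exact: Vf.
by exists p.
Qed.

Context (mS : manifold S).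

Lemma cinvK c p : S c -> cdom c p -> cinv c (cmap c p) = p.
Proof. by case: mS => _ _ H _ Sc; have [_ _ + _ _] := H c Sc; apply. Qed.

Lemma chart_image_open c (U : set M) :
  S c -> open U -> open (cmap c @` (cdom c `&` U)).
Proof.
case: mS => _ _ H _ Sc oU; have [od oi cK _ cc] := H c Sc.
rewrite openE => _ [p [cp Up] <-].
have Np : nbhs (cmap c p) (cmap c @` cdom c).
  by apply: open_nbhs_nbhs; split=> //; exists p.
have NU : nbhs (cmap c p) (cinv c @^-1` U).
  by apply: (cc p cp); rewrite cK//; apply: open_nbhs_nbhs.
apply: filterS (filterI Np NU) => _ [[q cq <-]] /=; rewrite cK// => Uq.
by exists q.
Qed.

Section Open.
Context (U : set M) (oU : open U).

Lemma smooth_on_eq (f g : M -> R) :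
  (forall p, U p -> f p = g p) -> smooth_on S U f -> smooth_on S U g.
Proof.
move=> fg sf c Sc k; apply: (Ck_on_eq (chart_image_open Sc oU)) (sf c Sc k).
by move=> _ [p [cp Up] <-] /=; rewrite (cinvK Sc cp) fg.
Qed.

Lemma smooth_on_cst (a : R) : smooth_on S U (fun=> a).
Proof. by move=> c Sc k; exact: Ck_on_cst. Qed.

Lemma smooth_onD (f g : M -> R) : smooth_on S U f -> smooth_on S U g ->
  smooth_on S U (fun p => f p + g p).
Proof.
move=> sf sg c Sc k.
exact: (Ck_onD (chart_image_open Sc oU) (sf c Sc k) (sg c Sc k)).
Qed.

Lemma smooth_onM (f g : M -> R) : smooth_on S U f -> smooth_on S U g ->
  smooth_on S U (fun p => f p * g p).
Proof.
move=> sf sg c Sc k.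
exact: (Ck_onM (chart_image_open Sc oU) (sf c Sc k) (sg c Sc k)).
Qed.

Lemma smooth_on_sum m (f : 'I_m -> M -> R) : (forall i, smooth_on S U (f i)) ->
  smooth_on S U (fun p => \sum_(i < m) f i p).
Proof.
elim: m f => [|m IH] f sf.
  by apply: smooth_on_eq (smooth_on_cst 0) => p _; rewrite big_ord0.
have := smooth_onD (IH _ (fun i => sf (widen_ord (leqnSn m) i))) (sf ord_max).
by apply: smooth_on_eq => p _; rewrite big_ord_recr.
Qed.

End Open.

Lemma smooth_on_slice (W : set (M * R)) (f : M * R -> R) (t : R) :
  smooth_on (line_atlas S) W f ->
  smooth_on S [set p | W (p, t)] (fun p => f (p, t)).
Proof.
move=> sf c Sc k.
have sfc := sf _ (ex_intro2 _ _ c Sc erefl : line_atlas S (line_chart c)) k.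
have := Ck_on_slice (t := t) _ sfc.
move=> /(_ (cmap c @` (cdom c `&` [set p | W (p, t)]))) H.
have -> : (fun p => f (p, t)) \o cinv c
    = (fun x => (f \o cinv (line_chart c)) (row_mx x t%:M)).
  by apply: funext => x /=; rewrite row_mxKl row_mxKr mxE eqxx mulr1n.
by apply: H => _ [p [cp Wp] <-]; exists (p, t).
Qed.

Lemma smooth_on_fst (U : set M) (f : M -> R) :
  smooth_on S U f -> smooth_on (line_atlas S) [set q | U q.1] (fun q => f q.1).
Proof.
move=> sf _ [c Sc <-] k; have := Ck_on_lsubmx _ (sf c Sc k); apply.
by move=> _ [q [cq Uq] <-]; rewrite row_mxKl; exists q.1.
Qed.

(** The image of a cylinder under a product chart is the preimage of an open set
    by [lsubmx], hence open; this is what the product rule needs. *)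
Lemma smooth_on_expN_fst (U : set M) (f : M -> R) : open U ->
  smooth_on S U f ->
  smooth_on (line_atlas S) [set q | U q.1] (fun q => expR (- q.2) * f q.1).
Proof.
move=> oU sf _ [c Sc <-] k; apply: Ck_on_sub; last first.
  apply: Ck_onM; last exact: (smooth_on_fst sf (ex_intro2 _ _ c Sc erefl)).
    have -> : cmap (line_chart c) @` (cdom (line_chart c) `&` [set q | U q.1])
        = lsubmx @^-1` (cmap c @` (cdom c `&` U)).
      apply/seteqP; split=> [_ [q [cq Uq] <-]|x [p [cp Up] xp]] /=.
        by rewrite row_mxKl; exists q.1.
      exists (p, rsubmx x 0 0) => //=; rewrite xp -[RHS]hsubmxK; congr row_mx.
      by rewrite [RHS]mx11_scalar.
    apply: open_comp (chart_image_open Sc oU) => x _.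
    exact: continuous_lsubmx.
  exact: Ck_on_exp.
exact: subset_refl.
Qed.

End SmoothFunctions.

(** * Local frames and dual frames *)

Section Frames.
Context {R : realType} {M : topologicalType}.

(** Evaluation of covectors with values in R, whereas the generic lemmas on linear
    functions produce values in the regular module [R^o]. *)
Section DualFibre.
Context (V : vbundle R M) (p : M).
Implicit Types (a b : dual V p) (x : V p).

Lemma dualD a b x : (a + b) x = a x + b x. Proof. exact: add_lfunE. Qed.
Lemma dualN a x : (- a) x = - a x. Proof. exact: opp_lfunE. Qed.
Lemma dualB a b x : (a - b) x = a x - b x. Proof. by rewrite dualD dualN. Qed.
Lemma dualZ c a x : (c *: a) x = c * a x. Proof. exact: scale_lfunE. Qed.
Lemma dual0 x : (0 : dual V p) x = 0. Proof. exact: zero_lfunE. Qed.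
Lemma dual_sum I (r : seq I) (f : I -> dual V p) x :
  (\sum_(i <- r) f i) x = \sum_(i <- r) f i x.
Proof. exact: sum_lfunE. Qed.

Lemma dual_eq a b : (forall x, a x = b x) -> a = b.
Proof. by move=> ab; apply/lfunP. Qed.

Lemma evalD a x y : a (x + y) = a x + a y :> R. Proof. exact: linearD. Qed.
Lemma evalB a x y : a (x - y) = a x - a y :> R. Proof. exact: linearB. Qed.
Lemma evalZ a c x : a (c *: x) = c * a x :> R. Proof. exact: linearZ. Qed.
Lemma eval0 a : a 0 = 0 :> R. Proof. exact: linear0. Qed.
Lemma eval_sum I (r : seq I) (f : I -> V p) a :
  a (\sum_(i <- r) f i) = \sum_(i <- r) a (f i) :> R.
Proof. exact: linear_sum. Qed.

End DualFibre.

(** The part of [vector_bundle] which the dual bundle visibly inherits, without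
    any smoothness of transition functions. *)
Definition framed (V : vbundle R M) : Prop :=
  [/\ forall p, exists2 F : lframe V (vrank V), frames F & fdom F p,
      forall F : lframe V (vrank V), frames F -> open (fdom F) &
      forall F : lframe V (vrank V), frames F -> forall p, fdom F p ->
        basis_of fullv (frame_at F p)].

Lemma frame_expand (V : vbundle R M) (F : lframe V (vrank V)) p (x : V p) :
  basis_of fullv (frame_at F p) ->
  x = \sum_j coord (frame_at F p) j x *: fvec F j p.
Proof.
move=> bF; rewrite {1}(coord_basis bF (memvf x)).
by apply: eq_bigr => j _; rewrite -tnth_nth tnth_mktuple.
Qed.

Lemma dual_frame_free (V : vbundle R M) (F : lframe V (vrank V)) p i j :
  basis_of fullv (frame_at F p) ->
  fvec (dual_frame F) j p (fvec F i p) = (i == j)%:R.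
Proof.
move=> bF; rewrite /= lfunE/= -(coord_free i j (basis_free bF)).
by rewrite -tnth_nth tnth_mktuple.
Qed.

Lemma dual_frame_expand (V : vbundle R M) (F : lframe V (vrank V)) p
    (a : dual V p) :
  basis_of fullv (frame_at F p) ->
  a = \sum_j a (fvec F j p) *: fvec (dual_frame F) j p.
Proof.
move=> bF; apply: dual_eq => x; rewrite (frame_expand x bF) !eval_sum.
apply: eq_bigr => i _; rewrite !evalZ; congr (_ * _).
rewrite dual_sum (bigD1 i)//= big1 => [|j ji].
  by rewrite addr0 dualZ dual_frame_free// eqxx mulr1.
by rewrite dualZ dual_frame_free// eq_sym (negPf ji) mulr0.
Qed.

Lemma dual_frame_basis (V : vbundle R M) (F : lframe V (vrank V)) p :
  basis_of fullv (frame_at F p) ->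
  basis_of fullv (frame_at (V := dual V) (dual_frame F) p).
Proof.
move=> bF; set X := frame_at _ p.
have XE (j : 'I_(vrank V)) : X`_j = fvec (dual_frame F) j p by rewrite -tnth_nth tnth_mktuple.
apply/andP; split.
  rewrite eqEsubv subvf; apply/subvP => a _; rewrite (dual_frame_expand a bF).
  apply: memv_suml => j _; apply: memvZ; rewrite -XE; apply: memv_span.
  by rewrite mem_nth// size_tuple.
apply/freeP => k k0 i.
have := congr1 (fun a : dual V p => a (fvec F i p)) k0.
rewrite dual0 dual_sum (bigD1 i)//= big1 => [|j ji].
  by rewrite addr0 dualZ XE dual_frame_free// eqxx mulr1.
by rewrite dualZ XE dual_frame_free// eq_sym (negPf ji) mulr0.
Qed.

Lemma coord_dual_frame (V : vbundle R M) (F : lframe V (vrank V)) p j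
    (a : dual V p) :
  basis_of fullv (frame_at F p) ->
  coord (frame_at (V := dual V) (dual_frame F) p) j a = a (fvec F j p).
Proof.
move=> bF; have bD := dual_frame_basis bF.
rewrite {2}(frame_expand (V := dual V) a bD) dual_sum (bigD1 j)//= big1 => [|i ij].
  by rewrite addr0 dualZ dual_frame_free// eqxx mulr1.
by rewrite dualZ dual_frame_free// eq_sym (negPf ij) mulr0.
Qed.

Lemma framed_dual (V : vbundle R M) : framed V -> framed (dual V).
Proof.
case=> cF oF bF; split.
- by move=> p; have [F VF Fp] := cF p; exists (dual_frame F) => //; exists F.
- by move=> _ [F VF <-]; exact: oF.
- by move=> _ [F VF <-] p Fp; apply: dual_frame_basis; exact: bF.
Qed.

Lemma vector_bundle_framed n (S : set (chart R M n)) (V : vbundle R M) :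
  vector_bundle S V -> framed V.
Proof. by case. Qed.

End Frames.

(** * Smooth sections of a bundle and of its product with the line *)

Section Sections.
Context {R : realType} {M : topologicalType} {n : nat} (S : set (chart R M n)).
Context (mS : manifold S).

(** In a local frame the pairing is the sum of the products of the coordinates,
    because the dual frame is the dual basis. *)
Lemma smooth_pairing (V : vbundle R M) (a : vsection (dual V)) (X : vsection V) :
  framed V -> smooth_section S a -> smooth_section S X ->
  smooth_fun S (fun p => a p (X p)).
Proof.
case=> cF oF bF sa sX; apply: smooth_on_cover => p _.
have [F VF Fp] := cF p; exists (fdom F) => //.
have oFT : open (fdom F `&` setT) by rewrite setIT; exact: oF.
have := smooth_on_sum mS oFT (fun j : 'I_(vrank V) =>
  smooth_onM mS oFT (sX F VF j) (sa _ (ex_intro2 _ _ F VF erefl) j)).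
rewrite setIT; apply: smooth_on_eq => // [|q Fq]; first exact: oF.
rewrite [X in a q X](frame_expand (X q) (bF F VF q Fq)) eval_sum.
apply: eq_bigr => j _; rewrite evalZ.
by rewrite (coord_dual_frame _ _ (bF F VF q Fq)).
Qed.

Lemma smooth_sectionZ (V : vbundle R M) (c : R) (X : vsection V) :
  framed V -> smooth_section S X -> smooth_section S (fun p => c *: X p : V p).
Proof.
case=> _ oF _ sX F VF j.
have oFT : open (fdom F `&` setT) by rewrite setIT; exact: oF.
have := smooth_onM mS oFT (smooth_on_cst (S := S) _ c) (sX F VF j).
by apply: smooth_on_eq => // p _; rewrite linearZ.
Qed.

(** Both bundles have the same fibres by conversion; it remains to compare frames. *)
Lemma line_dual (V : vbundle R M) : 
  @frames R _ (dual (line V)) = @frames R _ (line (dual V)).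
Proof.
apply/seteqP; split=> [_ [_ [F VF <-] <-]|_ [_ [F VF <-] <-]].
  by exists (dual_frame F) => //; exists F.
by exists (line_frame F) => //; exists F.
Qed.

Lemma smooth_section_on_slice (V : vbundle R M) (W : set (M * R))
    (X : vsection (line V)) t :
  smooth_section_on (line_atlas S) W X ->
  smooth_section_on S [set p | W (p, t)] (slice t X).
Proof.
move=> sX F VF j.
exact: (smooth_on_slice t (sX _ (ex_intro2 _ _ F VF erefl) j)).
Qed.

Definition const_lift (V : vbundle R M) (X : vsection V) : vsection (line V) :=
  fun q => X q.1.

(** The lift that turns sections of D into sections of D~. *)
Definition exp_lift (V : vbundle R M) (X : vsection V) : vsection (line V) :=
  fun q => expR (- q.2) *: X q.1.

Lemma smooth_section_on_const_lift (V : vbundle R M) (U : set M) (X : vsection V) :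
  smooth_section_on S U X ->
  smooth_section_on (line_atlas S) [set q | U q.1] (const_lift X).
Proof.
by move=> sX _ [F VF <-] j; exact: (smooth_on_fst (sX F VF j)).
Qed.

Lemma smooth_section_on_exp_lift (V : vbundle R M) (U : set M) (X : vsection V) :
  framed V -> open U -> smooth_section_on S U X ->
  smooth_section_on (line_atlas S) [set q | U q.1] (exp_lift X).
Proof.
case=> _ oF _ oU sX _ [F VF <-] j.
have oFU : open (fdom F `&` U) by apply: openI => //; exact: oF.
have := smooth_on_expN_fst mS oFU (sX F VF j).
congr smooth_on; apply: funext => q /=.
by rewrite [RHS]linearZ.
Qed.

Lemma smooth_slice (V : vbundle R M) (X : vsection (line V)) t :
  smooth_section (line_atlas S) X -> smooth_section S (slice t X).
Proof. by move=> sX; exact: (smooth_section_on_slice t sX). Qed.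

Lemma smooth_const_lift (V : vbundle R M) (X : vsection V) :
  smooth_section S X -> smooth_section (line_atlas S) (const_lift X).
Proof. by move=> sX; exact: (smooth_section_on_const_lift sX). Qed.

Lemma smooth_exp_lift (V : vbundle R M) (X : vsection V) : framed V ->
  smooth_section S X -> smooth_section (line_atlas S) (exp_lift X).
Proof. by move=> fV sX; exact: (smooth_section_on_exp_lift fV openT sX). Qed.

Lemma smooth_section_on_line_dual (V : vbundle R M) (W : set (M * R))
    (a : vsection (line (dual V))) :
  smooth_section_on (line_atlas S) (V := dual (line V)) W a <->
  smooth_section_on (line_atlas S) (V := line (dual V)) W a.
Proof.
split=> sa F VF j.
  by apply: (sa F); rewrite line_dual.
by apply: (sa F); rewrite -line_dual.
Qed.

End Sections.

(** * Time derivatives of sections *)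

Section Curves.
Context {R : realType}.

Lemma is_derive_sum_fun m (h : 'I_m -> R -> R) (dh : 'I_m -> R) (t : R) :
  (forall i, is_derive t 1 (h i) (dh i)) ->
  is_derive t 1 (fun s => \sum_(i < m) h i s) (\sum_(i < m) dh i).
Proof.
move=> H; have := is_derive_sum H; congr is_derive.
by apply: funext => s; rewrite fct_sumE.
Qed.

Lemma coord_sum (U : vectType R) m k (e : k.-tuple U) j (a : 'I_m -> R)
    (v : 'I_m -> U) :
  coord e j (\sum_i a i *: v i) = \sum_i a i * coord e j (v i).
Proof. by rewrite linear_sum; apply: eq_bigr => i _; rewrite linearZ. Qed.

Definition curve_derivable (U : vectType R) (g : R -> U) (t : R) : Prop :=
  forall j, derivable (fun s => coord (vbasis fullv) j (g s) : R) t 1.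

Context {M : topologicalType} {V : vbundle R M} {p : M}.

Lemma eval_curve_derive (a : dual V p) (x : R -> V p) t :
  curve_derivable x t ->
  is_derive t 1 (fun s => a (x s) : R) (a (curve_derive x t)).
Proof.
move=> dx; rewrite /curve_derive eval_sum.
have -> : (fun s => a (x s) : R) = fun s => \sum_j
    coord (vbasis fullv) j (x s) * a (vbasis (fullv : {vspace V p}))`_j.
  apply: funext => s; rewrite {1}(coord_vbasis (memvf (x s))) eval_sum.
  by apply: eq_bigr => j _; rewrite evalZ.
apply: is_derive_sum_fun => j; rewrite evalZ mulrC.
have := is_deriveZ (a (vbasis (fullv : {vspace V p}))`_j) (derivableP (dx j)).
by rewrite derive1E; congr is_derive; apply: funext => s /=; rewrite mulrC.
Qed.

Lemma curve_derive_at (a : R -> dual V p) (x : V p) t :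
  curve_derivable a t ->
  is_derive t 1 (fun s => a s x : R) (curve_derive a t x).
Proof.
move=> da; rewrite /curve_derive dual_sum.
have -> : (fun s => a s x : R) = fun s => \sum_j
    coord (vbasis fullv) j (a s) *
      ((vbasis (fullv : {vspace dual V p}))`_j : dual V p) x.
  apply: funext => s; rewrite {1}(coord_vbasis (memvf (a s))) dual_sum.
  by apply: eq_bigr => j _; rewrite dualZ.
apply: is_derive_sum_fun => j; rewrite dualZ mulrC.
have := is_deriveZ (((vbasis (fullv : {vspace dual V p}))`_j : dual V p) x)
  (derivableP (da j)).
by rewrite derive1E; congr is_derive; apply: funext => s /=; rewrite mulrC.
Qed.

(** Expanding x in a basis reduces the Leibniz rule to the one for real functions. *)
Lemma pairing_curve_derive (a : R -> dual V p) (x : R -> V p) t :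
  curve_derivable a t -> curve_derivable x t ->
  is_derive t 1 (fun s => a s (x s) : R)
    (curve_derive a t (x t) + a t (curve_derive x t)).
Proof.
move=> da dx.
pose v j := (vbasis (fullv : {vspace V p}))`_j.
pose k j s := coord (vbasis fullv) j (x s).
have xE s : x s = \sum_j k j s *: v j := coord_vbasis (memvf (x s)).
have -> : (fun s => a s (x s) : R) = fun s => \sum_j k j s * a s (v j).
  apply: funext => s; rewrite {1}xE eval_sum.
  by apply: eq_bigr => j _; rewrite evalZ.
have -> : curve_derive a t (x t) + a t (curve_derive x t) =
    \sum_j (k j t * curve_derive a t (v j) + a t (v j) * 'D_1 (k j) t).
  rewrite big_split/= {1}xE eval_sum; congr (_ + _).
    by apply: eq_bigr => j _; rewrite evalZ.
  rewrite [X in a t X]/curve_derive eval_sum; apply: eq_bigr => j _.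
  by rewrite evalZ derive1E mulrC.
apply: is_derive_sum_fun => j.
exact: is_deriveM (derivableP (dx j)) (curve_derive_at (v j) da).
Qed.

End Curves.

Section TimeDerivative.
Context {R : realType} {M : topologicalType} {n : nat} (S : set (chart R M n)).
Context (mS : manifold S).

(** Coordinates in a local frame are smooth along the line direction of a product
    chart; the fixed basis [vbasis] differs from the frame by constants, p being
    fixed. *)
Lemma smooth_curve_derivable (V : vbundle R M) (X : vsection (line V)) p t :
  framed V -> smooth_section (line_atlas S) X ->
  curve_derivable (fun s => X (p, s) : V p) t.
Proof.
case=> cF oF bF sX j; have [F VF Fp] := cF p.
case: (mS) => _ /(_ p) [c Sc cp] _ _.
have dF i : derivable (fun s => coord (frame_at F p) i (X (p, s)) : R) t 1.
  have [_ /(_ (rshift n ord0)) [+ _]] := sX _ (ex_intro2 _ _ F VF erefl) i _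
    (ex_intro2 _ _ c Sc erefl : line_atlas S (line_chart c)) 1%N.
  move=> /(_ (cmap (line_chart c) (p, t))) H.
  have {}H := H (ex_intro2 _ _ (p, t) (conj cp (conj Fp I)) erefl).
  set f := (X in derivable X _ _) in H.
  have -> : (fun s => coord (frame_at F p) i (X (p, s)))
      = f \o (fun s => cmap (line_chart c) (p, s)).
    apply: funext => s; rewrite /f/= row_mxKl row_mxKr mxE eqxx mulr1n.
    by rewrite (cinvK mS Sc cp).
  pose g := fun s => cmap (line_chart c) (p, s).
  have gE (h : R) : g (h *: 1 + t) = h *: delta_mx 0 (rshift n ord0) + g t.
    apply/matrixP => a b; rewrite /g/= !mxE.
    case: splitP => l bl; rewrite -!val_eqE (bl : val b = _)/= !ord1 addn0.
      by rewrite (ltn_eqF (ltn_ord l)) mulr0 add0r.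
    by rewrite !mxE !eqxx !mulr1n.
  exact: (@derive_affine R R 'rV[R]_(n + 1) f g t 1 _ gE).2 H.
have -> : (fun s => coord (vbasis fullv) j (X (p, s)) : R) = fun s =>
    \sum_i coord (frame_at F p) i (X (p, s)) *
      coord (vbasis fullv) j (fvec F i p).
  apply: funext => s.
  have E := congr1 (coord (vbasis fullv) j)
    (frame_expand (X (p, s) : V p) (bF F VF p Fp)).
  by rewrite coord_sum in E.
suff [] : is_derive t 1 (fun s => \sum_i coord (frame_at F p) i (X (p, s)) *
      coord (vbasis fullv) j (fvec F i p)) (\sum_i
      coord (vbasis fullv) j (fvec F i p) *: 'D_1
        (fun s => coord (frame_at F p) i (X (p, s)) : R) t) by [].
apply: is_derive_sum_fun => i.
have := is_deriveZ (coord (vbasis fullv) j (fvec F i p)) (derivableP (dF i)).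
by congr is_derive; apply: funext => s /=; rewrite mulrC.
Qed.

Lemma smooth_section_line_dual (V : vbundle R M) (a : vsection (line (dual V))) :
  smooth_section (line_atlas S) (V := dual (line V)) a ->
  smooth_section (line_atlas S) a.
Proof. by move=> /(smooth_section_on_line_dual S setT a). Qed.

Lemma dt_pairing (V : vbundle R M) (a : vsection (dual (line V)))
    (X : vsection (line V)) (p : M) (t : R) : framed V ->
  smooth_section (line_atlas S) a -> smooth_section (line_atlas S) X ->
  is_derive t 1 (fun s => (a (p, s) : dual V p) (X (p, s)) : R)
    ((dt (V := dual V) a (p, t) : dual V p) (X (p, t)) +
     (a (p, t) : dual V p) (dt X (p, t))).
Proof.
move=> fV /smooth_section_line_dual sa sX.
apply: (pairing_curve_derive (V := V) (p := p)
  (a := fun s => a (p, s)) (x := fun s => X (p, s))).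
  by apply: smooth_curve_derivable sa; exact: framed_dual.
exact: smooth_curve_derivable sX.
Qed.

End TimeDerivative.

(** * The bracket on A + A^* in components *)

Section Forms.
Context {R : realType} {M : Type} {V : vbundle R M}.
Context (L : algebroid V) (phi : Defs.form V).

Lemma dform1 (w : Defs.form V) X p : dform L w [:: X] p = lieder L X (w [::]) p.
Proof.
rewrite /dform/= !big_ord_recl !big_ord0/= big1 => [|i]; last by [].
by rewrite !addr0 expr0 mul1r.
Qed.

Lemma dform2 (w : Defs.form V) X Y p :
  dform L w [:: X; Y] p =
  lieder L X (w [:: Y]) p - lieder L Y (w [:: X]) p - w [:: br L X Y] p.
Proof.
rewrite /dform/= !big_ord_recl !big_ord0/= /bump/=.
rewrite !(big_mkcond (fun i : 'I_2 => (i < _)%N))/= !big_ord_recl !big_ord0/=.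
rewrite /bump/= /rem_nth /sect/= !addn0 !add0n expr0 expr1; ring.
Qed.

Hypothesis phi0 : forall p, phi [::] p = 0.

Lemma dform_tw1 (w : Defs.form V) X p :
  dform_tw L phi w [:: X] p = lieder L X (w [::]) p + phi [:: X] p * w [::] p.
Proof.
rewrite /dform_tw /form_add dform1 /wedge/= /iota_form/= phi0.
by rewrite !mulr0 mul0r addr0.
Qed.

(** The terms in lieder L Y (w [:: X]) and phi [:: Y] * w [:: X] occur in both
    summands of Cartan's formula and cancel. *)
Lemma lie_form_tw1 (w : Defs.form V) X Y p : w [::] p = 0 ->
  lie_form_tw L phi X w [:: Y] p =
  lieder L X (w [:: Y]) p - w [:: br L X Y] p + phi [:: X] p * w [:: Y] p.
Proof.
move=> w0; rewrite /lie_form_tw /form_add {1}/iota_form dform_tw1.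
rewrite /dform_tw /form_add dform2 /wedge/= /iota_form/= w0 phi0.
rewrite expr0 expr1; ring.
Qed.

End Forms.

Section CourantComponents.
Context {R : realType} {M : Type} {A : vbundle R M}.
Context (L : algebroid A) (Ls : algebroid (dual A)).

Lemma courant_AE (X0 : vsection A) X xi Y eta (b : vsection (dual A)) p :
  courant_A L Ls X0 X xi Y eta [:: b] p =
  b p (br L X Y p)
  + (lieder Ls xi (fun q => b q (Y q)) p - br Ls xi b p (Y p)
     + xi p (X0 p) * b p (Y p))
  - (lieder Ls eta (fun q => b q (X q)) p - br Ls eta b p (X p)
     + eta p (X0 p) * b p (X p))
  - (lieder Ls b (minus_fun X xi Y eta) p + b p (X0 p) * minus_fun X xi Y eta p).
Proof.
by rewrite /courant_A /lieAs /dAs /form_sub /form_add /form_scale !lie_form_tw1// dform_tw1//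
  !mulN1r.
Qed.

Lemma courant_AsE (phi0 : vsection (dual A)) X xi Y eta (B : vsection A) p :
  courant_As L Ls phi0 X xi Y eta [:: B] p =
  br Ls xi eta p (B p)
  + (lieder L X (fun q => eta q (B q)) p - eta p (br L X B p)
     + phi0 p (X p) * eta p (B p))
  - (lieder L Y (fun q => xi q (B q)) p - xi p (br L Y B p)
     + phi0 p (Y p) * xi p (B p))
  + (lieder L B (minus_fun X xi Y eta) p + phi0 p (B p) * minus_fun X xi Y eta p).
Proof.
by rewrite /courant_As /lieA /dA /form_sub /form_add /form_scale !lie_form_tw1// dform_tw1//
  !mulN1r.
Qed.

End CourantComponents.

Section LieAlgebroid.
Context {R : realType} {M : topologicalType} {n : nat} (S : set (chart R M n)).
Context {V : vbundle R M} (L : algebroid V).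
Context (mS : manifold S) (fV : framed V) (lL : lie_algebroid S L).
Implicit Types (X Y : vsection V) (f : M -> R).

(** The axioms speak of c X + X'; taking c - 1 and X' = X yields homogeneity.
    The anchor is handled in the same way below. *)
Lemma brZl c X Y p : smooth_section S X -> smooth_section S Y ->
  br L (fun q => c *: X q) Y p = c *: br L X Y p.
Proof.
case: lL => _ [_ brL _ _ _] sX sY.
have -> : (fun q => c *: X q) = (fun q => (c - 1) *: X q + X q) :> vsection V.
  by apply: functional_extensionality_dep => q; rewrite scalerBl scale1r subrK.
by rewrite brL// scalerBl scale1r subrK.
Qed.

Lemma brZr c X Y p : smooth_section S X -> smooth_section S Y ->
  br L X (fun q => c *: Y q) p = c *: br L X Y p.
Proof.
move=> sX sY; case: (lL) => _ [_ _ brN _ _].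
rewrite brN//; last exact: smooth_sectionZ.
by rewrite brZl// [in RHS]brN// scalerN.
Qed.

Lemma lieder_scale X f c p : smooth_fun S f ->
  lieder L X (fun q => c * f q) p = c * lieder L X f p.
Proof.
case: lL => -[_ aZ _ _] _ sf; rewrite /lieder.
have -> : (fun q => c * f q) = (fun q => (c - 1) * f q + f q).
  by apply: funext => q; ring.
by rewrite aZ//; ring.
Qed.

Lemma lieder_sectionZ X f c p : smooth_fun S f ->
  lieder L (fun q => c *: X q) f p = c * lieder L X f p.
Proof.
case: lL => -[aL _ _ _] _ sf; rewrite /lieder.
have -> : c *: X p = (c - 1) *: X p + X p by rewrite scalerBl scale1r subrK.
by rewrite aL//; ring.
Qed.

End LieAlgebroid.

(** * Linear algebra in a product of two spaces *)

Section PairSpaces.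
Context {R : realType} {U1 U2 : vectType R}.

Definition pairl (x : U1) : U1 * U2 := (x, 0).
Definition pairr (y : U2) : U1 * U2 := (0, y).

Fact pairl_linear : linear pairl.
Proof.
by move=> c x y; rewrite /pairl; congr pair; rewrite /= scaler0 addr0.
Qed.
Fact pairr_linear : linear pairr.
Proof.
by move=> c x y; rewrite /pairr; congr pair; rewrite /= scaler0 addr0.
Qed.
HB.instance Definition _ := GRing.isLinear.Build R U1 (U1 * U2)%type _ pairl pairl_linear.
HB.instance Definition _ := GRing.isLinear.Build R U2 (U1 * U2)%type _ pairr pairr_linear.

(** A subspace is cut out by linear functionals, here by the coordinates of
    [1 - projv W]; functionals on a product split into two, which is the form in
    which they can be differentiated along a curve of pairs. *)
Lemma mem_functionals (W : {vspace (U1 * U2)%type}) (u : U1 * U2) :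
  (forall (l1 : 'Hom(U1, R^o)) (l2 : 'Hom(U2, R^o)),
    (forall w, w \in W -> l1 w.1 + l2 w.2 = 0) -> l1 u.1 + l2 u.2 = 0) ->
  u \in W.
Proof.
move=> H; pose f := (\1 - projv W)%VF.
suff /eqP : f u = 0.
  by rewrite add_lfunE opp_lfunE id_lfunE subr_eq0 => /eqP ->; exact: memv_proj.
pose v := vbasis (fullv : {vspace (U1 * U2)%type}).
rewrite (coord_vbasis (memvf (f u))) big1// => j _.
pose g : 'Hom(_, R^o) := (linfun (coord v j : _ -> R^o) \o f)%VF.
suff : g u = 0 by rewrite /g comp_lfunE lfunE => ->; rewrite scale0r.
have gE w : g w = (g \o linfun pairl)%VF w.1 + (g \o linfun pairr)%VF w.2.
  have {1}-> : w = pairl w.1 + pairr w.2.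
    by case: w => x y; congr pair; rewrite /= ?addr0 ?add0r.
  by rewrite linearD !(comp_lfunE g) (lfunE pairl) (lfunE pairr).
rewrite gE; apply: H => w Ww; rewrite -gE comp_lfunE.
by rewrite add_lfunE opp_lfunE id_lfunE projv_id// subrr linear0.
Qed.

Definition scalel (c : R) (u : U1 * U2) : U1 * U2 := (c *: u.1, u.2).

Fact scalel_linear c : linear (scalel c).
Proof.
by move=> k x y; congr pair; rewrite /= scalerDr !scalerA mulrC.
Qed.
HB.instance Definition _ c :=
  GRing.isLinear.Build R (U1 * U2)%type (U1 * U2)%type _ (scalel c) (scalel_linear c).

Lemma scalelK c : c != 0 -> cancel (scalel c) (scalel c^-1).
Proof. by move=> c0 [x y]; rewrite /scalel /= scalerA mulVf// scale1r. Qed.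

Lemma mem_scalel c (W : {vspace (U1 * U2)%type}) u : c != 0 ->
  (u \in (linfun (scalel c) @: W)%VS) = (scalel c^-1 u \in W).
Proof.
move=> c0; apply/idP/idP => [/memv_imgP[w Ww ->]|Wu].
  by rewrite lfunE scalelK.
rewrite -[u](scalelK (invr_neq0 c0)) invrK; apply/memv_imgP.
by exists (scalel c^-1 u) => //; rewrite lfunE.
Qed.

Lemma free_scalel c (X : seq (U1 * U2)) : c != 0 ->
  free [seq scalel c u | u <- X] = free X.
Proof.
move=> c0; rewrite /free size_map; congr (_ == _).
have -> : [seq scalel c u | u <- X] = [seq linfun (scalel c) u | u <- X].
  by apply: eq_map => u; rewrite lfunE.
rewrite -limg_span; apply: limg_dim_eq; apply/eqP; rewrite -subv0.
apply/subvP => u; rewrite memv_cap memv0 memv_ker => /andP[_].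
rewrite lfunE => /eqP/(congr1 (scalel c^-1)); rewrite scalelK// => ->.
by rewrite linear0.
Qed.

End PairSpaces.

(** Replaces pairings and derivatives by variables: [ring] and [field] would
    otherwise compare these large terms up to conversion. *)
Ltac abstract_reals := repeat match goal with
  | |- context [@lieder ?R ?M ?V ?L ?X ?f ?p] =>
    let r := fresh "r" in
    move: (@lieder R M V L X f p : R); move=> r
  | |- context [@fun_of_lfun ?K ?U ?W ?f ?x] =>
    let r := fresh "r" in
    generalize (@fun_of_lfun K U W f x); intro r
  end.

Lemma diff_comb (R : realType) (U : lmodType R) (v w : R) (x x' y y' : U) :
  v *: (-1 *: y + y') + (- w *: (-1 *: x + x') + 0) =
  v *: (y' - y) - w *: (x' - x).
Proof. by rewrite addr0 !scaleN1r scaleNr ![- _ + _]addrC. Qed.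

Lemma expR_neq0 (R : realType) (t : R) : expR t != 0.
Proof. by rewrite gt_eqF// expR_gt0. Qed.

(** * The induced algebroids at a frozen time *)

Section Poissonization.
Context {R : realType} {M : topologicalType} {n : nat} (S : set (chart R M n)).
Context {A : vbundle R M} (L : algebroid A) (Ls : algebroid (dual A)).
Context (phi0 : vsection (dual A)) (X0 : vsection A).
Context (mS : manifold S) (fA : framed A).
Context (lL : lie_algebroid S L) (lLs : lie_algebroid S Ls).

Local Notation SL := (line_atlas S).
Local Notation bar := (bar_algebroid L phi0).
Local Notation hat := (hat_algebroid Ls X0).

(** If (X, xi) is a section of D~, then [(exp_slice t X, slice t xi)] is one of D. *)
Definition exp_slice (t : R) (X : vsection (line A)) : vsection A :=
  fun p => expR t *: slice t X p.

Lemma smooth_dual_slice t (a : vsection (line (dual A))) :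
  smooth_section SL (V := dual (line A)) a -> smooth_section S (slice t a).
Proof. by move=> /smooth_section_line_dual sa; exact: smooth_slice. Qed.

Lemma smooth_dual_lift (a : vsection (dual A)) :
  smooth_section S a ->
  smooth_section SL (V := dual (line A)) (const_lift a).
Proof.
by move=> sa; exact: (smooth_section_on_line_dual S setT _).2 (smooth_const_lift sa).
Qed.

Lemma smooth_exp_slice t (X : vsection (line A)) :
  smooth_section SL X -> smooth_section S (exp_slice t X).
Proof. by move=> sX; apply: smooth_sectionZ => //; exact: smooth_slice. Qed.

Local Notation ev q a x := ((a : dual A q) (x : A q) : R).

Lemma pairing_slice (a : vsection (line (dual A))) (X : vsection (line A)) q t :
  ev q (a (q, t)) (X (q, t)) =
  (expR t)^-1 * ev q (slice t a q) (exp_slice t X q).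
Proof. by rewrite /exp_slice evalZ mulKf ?expR_neq0. Qed.

Lemma smooth_pairing_slice (a : vsection (line (dual A)))
    (X : vsection (line A)) t :
  smooth_section SL (V := dual (line A)) a -> smooth_section SL X ->
  smooth_fun S (fun q => ev q (slice t a q) (exp_slice t X q)).
Proof.
move=> sa sX; apply: smooth_pairing => //; last exact: smooth_exp_slice.
exact: smooth_dual_slice.
Qed.

Lemma derive1_pairing (a : vsection (line (dual A))) (X : vsection (line A)) p t :
  smooth_section SL (V := dual (line A)) a -> smooth_section SL X ->
  derive1 (fun s : R => ev p (a (p, s)) (X (p, s))) t =
  ev p (dt a (p, t)) (X (p, t)) + ev p (a (p, t)) (dt X (p, t)).
Proof.
by move=> sa sX; have [_ <-] := dt_pairing mS p t fA sa sX; rewrite derive1E.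
Qed.

Lemma lieder_hat_pairing (a b : vsection (line (dual A))) (X : vsection (line A))
    p t :
  smooth_section SL (V := dual (line A)) b -> smooth_section SL X ->
  @lieder R _ (dual (line A)) hat a (fun q => ev q.1 (b q) (X q)) (p, t) =
  (expR t)^-1 *
   ((expR t)^-1 *
      lieder Ls (slice t a) (fun q => ev q (slice t b q) (exp_slice t X q)) p
    + ev p (a (p, t)) (X0 p) *
      (ev p (dt b (p, t)) (X (p, t)) + ev p (b (p, t)) (dt X (p, t)))).
Proof.
move=> sb sX; rewrite -derive1_pairing// -(lieder_scale lLs); last first.
  exact: smooth_pairing_slice.
rewrite -expRN {1}/lieder/=; congr (_ * (anchor Ls _ _ + _)).
by apply: funext => q; rewrite pairing_slice expRN.
Qed.

Lemma lieder_bar_pairing (a : vsection (line (dual A))) (X B : vsection (line A))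
    p t :
  smooth_section SL (V := dual (line A)) a -> smooth_section SL B ->
  @lieder R _ (line A) bar X (fun q => ev q.1 (a q) (B q)) (p, t) =
  (expR t)^-1 *
      lieder L (exp_slice t X) (fun q => ev q (slice t a q) (slice t B q)) p
  + ev p (phi0 p) (X (p, t)) *
      (ev p (dt a (p, t)) (B (p, t)) + ev p (a (p, t)) (dt B (p, t))).
Proof.
move=> sa sB; rewrite -derive1_pairing// (lieder_sectionZ lL) ?mulKf ?expR_neq0//.
by apply: smooth_pairing => //; [exact: smooth_dual_slice|exact: smooth_slice].
Qed.

(** The chain of [etrans] fixes the fibre in each step; rewriting would have to
    recognise the fibres of [dual (line A)] as those of [dual A] repeatedly. *)
Lemma br_hatE (a b : vsection (line (dual A))) p t (x : A p) :
  ev p (br hat a b (p, t)) x =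
  (expR t)^-1 * (ev p (br Ls (slice t a) (slice t b) p) x
    + ev p (a (p, t)) (X0 p) * (ev p (dt b (p, t)) x - ev p (b (p, t)) x)
    - ev p (b (p, t)) (X0 p) * (ev p (dt a (p, t)) x - ev p (a (p, t)) x)).
Proof.
rewrite -expRN; apply: etrans (dualZ (V := A) (p := p) _ _ _) _.
congr (_ * _); apply: etrans (dualB (V := A) (p := p) _ _ _) _.
congr (_ - _); last first.
  by apply: etrans (dualZ (V := A) (p := p) _ _ _) _; congr (_ * _); exact: dualB.
apply: etrans (dualD (V := A) (p := p) _ _ _) _; congr (_ + _).
by apply: etrans (dualZ (V := A) (p := p) _ _ _) _; congr (_ * _); exact: dualB.
Qed.

Lemma br_bar_sliceE (X B : vsection (line A)) p t (a : dual A p) :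
  smooth_section SL X -> smooth_section SL B ->
  ev p a (br bar X B (p, t)) =
  (expR t)^-1 * ev p a (br L (exp_slice t X) (slice t B) p)
    + ev p (phi0 p) (X (p, t)) * ev p a (dt B (p, t))
    - ev p (phi0 p) (B (p, t)) * ev p a (dt X (p, t)).
Proof.
move=> sX sB; have sXt := smooth_slice t sX; have sBt := smooth_slice t sB.
by rewrite /= evalB evalD !evalZ (brZl lL) // !evalZ mulKf ?expR_neq0.
Qed.

Lemma br_barE (X Y : vsection (line A)) p t (a : dual A p) :
  smooth_section SL X -> smooth_section SL Y ->
  ev p a (br bar X Y (p, t)) =
  (expR t)^-1 ^+ 2 * ev p a (br L (exp_slice t X) (exp_slice t Y) p)
    + ev p (phi0 p) (X (p, t)) * ev p a (dt Y (p, t))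
    - ev p (phi0 p) (Y (p, t)) * ev p a (dt X (p, t)).
Proof.
move=> sX sY; rewrite br_bar_sliceE// (brZr mS fA lL) ?evalZ.
- by rewrite expr2 mulrA mulfVK ?expR_neq0.
- exact: smooth_exp_slice.
- exact: smooth_slice.
Qed.

(** e^t times the sum of the coefficients of d/dt in the two anchors at X and xi. *)
Definition weight (X : vsection (line A)) (xi : vsection (line (dual A))) p t : R :=
  expR t * ev p (phi0 p) (X (p, t)) + ev p (xi (p, t)) (X0 p).

(** With X = e^t X~ and Y = e^t Y~ this is v (Y' - Y) - w (X' - X), v and w being
    the weights. *)
Definition drift_A (X : vsection (line A)) (xi : vsection (line (dual A)))
    (Y : vsection (line A)) (eta : vsection (line (dual A))) p t : A p :=
  expR t *: (weight X xi p t *: (dt Y (p, t) : A p)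
             - weight Y eta p t *: (dt X (p, t) : A p)).

Definition drift_As (X : vsection (line A)) (xi : vsection (line (dual A)))
    (Y : vsection (line A)) (eta : vsection (line (dual A))) p t : dual A p :=
  weight X xi p t *: ((dt eta (p, t) : dual A p) - eta (p, t))
  - weight Y eta p t *: ((dt xi (p, t) : dual A p) - xi (p, t)).

Section At.
Context (X Y : vsection (line A)) (xi eta : vsection (line (dual A))).
Context (sX : smooth_section SL X) (sY : smooth_section SL Y).
Context (sxi : smooth_section SL (V := dual (line A)) xi)
  (seta : smooth_section SL (V := dual (line A)) eta).
Context (p : M) (t : R).
(* e1 and e2 being the pairs (e^t X, xi) and (e^t Y, eta), these state that the
   derivative of e1 is orthogonal to e2, and that of e2 to e1. *)
Context (iso1 : ev p (dt xi (p, t)) (Y (p, t)) + ev p (eta (p, t)) (dt X (p, t))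
  + ev p (eta (p, t)) (X (p, t)) = 0).
Context (iso2 : ev p (dt eta (p, t)) (X (p, t)) + ev p (xi (p, t)) (dt Y (p, t))
  + ev p (xi (p, t)) (Y (p, t)) = 0).

Let E := expR t.

Lemma minus_fun_slice q : @minus_fun R (M * R)%type (line A) X xi Y eta (q, t) =
  E^-1 * minus_fun (exp_slice t X) (slice t xi) (exp_slice t Y) (slice t eta) q.
Proof.
rewrite /minus_fun /pair_minus /= /exp_slice !evalZ /slice -/E.
have E0 : E != 0 := expR_neq0 t.
by field.
Qed.

Let minus_exp :=
  minus_fun (exp_slice t X) (slice t xi) (exp_slice t Y) (slice t eta).

Let smooth_minus : smooth_fun S minus_exp.
Proof.
have s1 := smooth_pairing_slice t sxi sY.
have s2 := smooth_pairing_slice t seta sX.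
have := smooth_onM mS openT (smooth_on_cst (S := S) _ 2^-1) (smooth_onD mS openT s1
  (smooth_onM mS openT (smooth_on_cst (S := S) _ (-1)) s2)).
by congr smooth_on; apply: funext => q; rewrite mulN1r.
Qed.

Lemma derive1_minus_fun :
  derive1 (fun s => @minus_fun R (M * R)%type (line A) X xi Y eta (p, s)) t =
  2^-1 * (ev p (dt xi (p, t)) (Y (p, t)) + ev p (xi (p, t)) (dt Y (p, t))
    - (ev p (dt eta (p, t)) (X (p, t)) + ev p (eta (p, t)) (dt X (p, t)))).
Proof.
have d1 := dt_pairing mS p t fA sxi sY.
have d2 := dt_pairing mS p t fA seta sX.
have [_ d12] := is_deriveZ 2^-1 (is_deriveB d1 d2).
by rewrite derive1E; exact: d12.
Qed.

Lemma lieder_hat_minus (b : vsection (line (dual A))) :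
  @lieder R _ (dual (line A)) hat b (@minus_fun R _ (line A) X xi Y eta) (p, t) =
  E^-1 * (E^-1 * lieder Ls (slice t b) minus_exp p + ev p (b (p, t)) (X0 p) *
    (2^-1 * (ev p (dt xi (p, t)) (Y (p, t)) + ev p (xi (p, t)) (dt Y (p, t))
    - (ev p (dt eta (p, t)) (X (p, t)) + ev p (eta (p, t)) (dt X (p, t)))))).
Proof.
rewrite -derive1_minus_fun -(lieder_scale lLs)// {1}/E -expRN /lieder/=.
congr (_ * (anchor Ls _ _ + _)).
by apply: funext => q; rewrite minus_fun_slice /E -?expRN.
Qed.

Lemma lieder_bar_minus (B : vsection (line A)) :
  @lieder R _ (line A) bar B (@minus_fun R _ (line A) X xi Y eta) (p, t) =
  E^-1 * lieder L (slice t B) minus_exp p + ev p (phi0 p) (B (p, t)) *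
    (2^-1 * (ev p (dt xi (p, t)) (Y (p, t)) + ev p (xi (p, t)) (dt Y (p, t))
    - (ev p (dt eta (p, t)) (X (p, t)) + ev p (eta (p, t)) (dt X (p, t))))).
Proof.
rewrite -derive1_minus_fun -(lieder_scale lL)// /lieder/=.
congr (anchor L _ _ + _).
by apply: funext => q; exact: minus_fun_slice.
Qed.

(** Substituting [iso1] and [iso2] for <eta, X'> and <xi, Y'> makes the multiple of
    X0 disappear; what remains is an identity of rational functions. *)
Lemma courant_A_line (b : vsection (line (dual A))) :
  smooth_section SL (V := dual (line A)) b ->
  @courant_A R (M * R)%type (line A) bar hat (fun=> 0) X xi Y eta [:: b] (p, t) =
  E ^- 2 *
   (courant_A L Ls X0 (exp_slice t X) (slice t xi) (exp_slice t Y) (slice t eta)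
      [:: slice t b] p
    + ev p (b (p, t)) (drift_A X xi Y eta p t)).
Proof.
move=> sb; rewrite !courant_AE (br_barE _ _ sX sY).
rewrite (lieder_hat_pairing xi p t sb sY) (lieder_hat_pairing eta p t sb sX) !br_hatE.
rewrite lieder_hat_minus minus_fun_slice !eval0 !mul0r -/minus_exp.
rewrite {3}/minus_exp /minus_fun/pair_minus/= /exp_slice !evalZ.
rewrite /drift_A evalB !evalZ /weight /slice -!/E.
have -> : ev p (eta (p, t)) (dt X (p, t)) =
    - (ev p (dt xi (p, t)) (Y (p, t)) + ev p (eta (p, t)) (X (p, t))).
  apply/eqP; rewrite -addr_eq0; apply/eqP; rewrite -iso1; ring.
have -> : ev p (xi (p, t)) (dt Y (p, t)) =
    - (ev p (dt eta (p, t)) (X (p, t)) + ev p (xi (p, t)) (Y (p, t))).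
  apply/eqP; rewrite -addr_eq0; apply/eqP; rewrite -iso2; ring.
move: E (expR_neq0 t : E != 0) => e e0.
by abstract_reals; field.
Qed.

(** As for the component in A, with phi0 in place of X0. *)
Lemma courant_As_line (B : vsection (line A)) :
  smooth_section SL B ->
  @courant_As R (M * R)%type (line A) bar hat (fun=> 0) X xi Y eta [:: B] (p, t) =
  E^-1 *
   (courant_As L Ls phi0 (exp_slice t X) (slice t xi) (exp_slice t Y) (slice t eta)
      [:: slice t B] p
    + ev p (drift_As X xi Y eta p t) (B (p, t))).
Proof.
move=> sB; rewrite !courant_AsE (br_bar_sliceE _ _ sX sB) (br_bar_sliceE _ _ sY sB).
rewrite (lieder_bar_pairing X p t seta sB) (lieder_bar_pairing Y p t sxi sB) br_hatE.
rewrite lieder_bar_minus minus_fun_slice !dual0 !mul0r -/minus_exp.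
rewrite {3}/minus_exp /minus_fun/pair_minus/= /exp_slice !evalZ.
rewrite /drift_As dualB !dualZ !dualB /weight /slice -!/E.
have -> : ev p (eta (p, t)) (dt X (p, t)) =
    - (ev p (dt xi (p, t)) (Y (p, t)) + ev p (eta (p, t)) (X (p, t))).
  apply/eqP; rewrite -addr_eq0; apply/eqP; rewrite -iso1; ring.
have -> : ev p (xi (p, t)) (dt Y (p, t)) =
    - (ev p (dt eta (p, t)) (X (p, t)) + ev p (xi (p, t)) (Y (p, t))).
  apply/eqP; rewrite -addr_eq0; apply/eqP; rewrite -iso2; ring.
move: E (expR_neq0 t : E != 0) => e e0.
by abstract_reals; field.
Qed.

End At.

(** * Dirac structures under rescaling of the first component *)

(** The field D~: the fibre at (p, t) is the image of D_p under
    (x, a) |-> (e^(-t) x, a). *)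
Definition line_rel (D : forall p, A p -> dual A p -> Prop) :
    forall q, line A q -> dual (line A) q -> Prop :=
  fun q x a => D q.1 (expR q.2 *: x) a.

Arguments line_rel D q x a : clear implicits.

Implicit Type D : forall p, A p -> dual A p -> Prop.

Lemma line_rel0 D p (x : A p) (a : dual A p) : line_rel D (p, 0) x a <-> D p x a.
Proof. by rewrite /line_rel /= expR0 scale1r. Qed.

(** (x, a) |-> (e^(-t) x, a) multiplies the symmetric pairing by e^(-t), hence
    maps maximal isotropic subspaces to such, in both directions; in t = 0 it is
    the identity. *)
Lemma maximally_isotropic_line D :
  maximally_isotropic (line_rel D) <-> maximally_isotropic D.
Proof.
split=> H.
  move=> p; have [W [WD iW mW]] := H (p, 0); exists W; split => //.
  by move=> x a; rewrite -WD line_rel0.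
move=> [p t]; have [W [WD iW mW]] := H p.
have e0 := expR_neq0 t; have e1 := invr_neq0 e0.
have pairE c (u v : A p * dual A p) :
    pair_plus (scalel c u) (scalel c v) = c * pair_plus u v.
  by rewrite /pair_plus/= !evalZ -mulrDr mulrCA.
exists (linfun (scalel (expR t)^-1) @: W)%VS; split.
- by move=> x a; rewrite mem_scalel// invrK -WD.
- move=> u v; rewrite !mem_scalel// invrK => Wu Wv.
  apply: (mulfI e0); rewrite mulr0 -[RHS](iW _ _ Wu Wv).
  by rewrite -pairE.
- move=> W' iW' WW'; have := mW (linfun (scalel (expR t)) @: W')%VS.
  move=> <-.
  + apply/vspaceP => u; rewrite mem_scalel// invrK mem_scalel//.
    by rewrite (scalelK e0).
  + move=> u v; rewrite !mem_scalel// => Wu Wv.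
    by apply: (mulfI e1); rewrite mulr0 -[RHS](iW' _ _ Wu Wv) -pairE.
  + apply/subvP => u Wu; rewrite mem_scalel//; apply: (subvP WW').
    by rewrite mem_scalel// invrK -{1}[expR t]invrK (scalelK e1).
Qed.

Lemma slice_open (W : set (M * R)) t : open W -> open [set p | W (p, t)].
Proof.
move=> oW; apply: (@open_comp _ _ (fun p : M => (p, t))) oW => p _.
  exact: (cvg_pair (F := nbhs p) (f := id) (g := fun=> t) cvg_id (cvg_cst t)).
Qed.

Lemma cylinder_open (U : set M) : open U -> open [set q : M * R | U q.1].
Proof. by move=> oU; apply: (@open_comp _ _ fst) oU => q _; exact: cvg_fst. Qed.

Lemma subbundle_line D :
  @subbundle R (M * R)%type (n + 1) SL (line A) (line_rel D) <-> subbundle S D.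
Proof.
split=> H.
  move=> p; have [W [k [X [xi [oW Wp sX DW]]]]] := H (p, 0).
  exists [set q | W (q, 0)], k, (fun j => slice 0 (X j)),
    (fun j => slice (V := dual A) 0 (xi j)); split=> //.
  - exact: slice_open.
  - move=> j; have [sXj sxij] := sX j; split.
      exact: (smooth_section_on_slice 0 sXj).
    exact: (smooth_section_on_slice (V := dual A) 0
      ((smooth_section_on_line_dual S W (xi j)).1 sxij)).
  - move=> q Wq; have [fX DX] := DW _ Wq; split=> // x a.
    by rewrite -line_rel0; exact: DX.
move=> [p s]; have [U [k [X [xi [oU Up sX DU]]]]] := H p.
exists [set q | U q.1], k, (fun j => exp_lift (X j)),
  (fun j => const_lift (V := dual A) (xi j)); split=> //.
- exact: cylinder_open.
- move=> j; have [sXj sxij] := sX j; split.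
    exact: smooth_section_on_exp_lift.
  apply: (smooth_section_on_line_dual S _ _).2.
  exact: smooth_section_on_const_lift sxij.
- move=> [q t] /= Uq; have [fX DX] := DU _ Uq.
  set T := [tuple ((X j q, xi j q) : (A q * dual A q)%type) | j < k] in fX DX.
  have e0 := invr_neq0 (expR_neq0 t).
  have TE : [tuple ((exp_lift (X j) (q, t), const_lift (V := dual A) (xi j) (q, t))
      : (A q * dual A q)%type) | j < k] = [seq scalel (expR t)^-1 u | u <- T] :> seq _.
    by rewrite /= -map_comp; apply: eq_map => j; rewrite /= /scalel -expRN.
  split; first by rewrite TE free_scalel.
  move=> x a; rewrite /line_rel/= DX TE.
  have -> : [seq scalel (expR t)^-1 u | u <- T] =
      [seq linfun (scalel (expR t)^-1) u | u <- T].
    by apply: eq_map => u; rewrite lfunE.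
  by rewrite -limg_span mem_scalel// invrK.
Qed.

Lemma max_isotropic_linear D : maximally_isotropic D ->
  forall p c x a y b, D p x a -> D p y b -> D p (c *: x + y) (c *: a + b).
Proof.
move=> H p c x a y b; have [W [WD _ _]] := H p; rewrite !WD => Wx Wy.
exact: memvD (memvZ c Wx) Wy.
Qed.

Lemma max_isotropic_pairing D : maximally_isotropic D ->
  forall p x a y b, D p x a -> D p y b -> ev p a y + ev p b x = 0.
Proof.
move=> H p x a y b; have [W [WD iW _]] := H p; rewrite !WD => Wx Wy.
have := iW _ _ Wx Wy; rewrite /pair_plus/= => /eqP.
by rewrite mulf_eq0 invr_eq0 pnatr_eq0/= => /eqP.
Qed.

(** The pair (e^s X, xi) stays in the subspace D_p for all s; each functional that
    vanishes on D_p vanishes on it, and so on its derivative at s = t. *)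
Lemma line_rel_time_derive D (X : vsection (line A)) (xi : vsection (line (dual A))) p t :
  maximally_isotropic D ->
  smooth_section SL X -> smooth_section SL (V := dual (line A)) xi ->
  (forall q, line_rel D q (X q) (xi q)) ->
  D p (expR t *: (X (p, t) + dt X (p, t))) (dt xi (p, t)).
Proof.
move=> mD sX /smooth_section_line_dual sxi DX.
have [W [WD _ _]] := mD p; rewrite WD; apply: mem_functionals => l1 l2 lW.
have d1 := eval_curve_derive (V := A) (p := p) l1
  (smooth_curve_derivable mS fA sX).
have d2 := eval_curve_derive (V := dual A) (p := p) l2
  (smooth_curve_derivable mS (framed_dual fA) sxi).
have [_ dE] := is_deriveD (is_deriveM (is_derive_expR t) (d1 t)) (d2 t).
have z : (fun s => expR s * (l1 (X (p, s)) : R) + (l2 (xi (p, s)) : R)) = fun=> 0.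
  apply: funext => s; have /WD/lW := DX (p, s).
  by rewrite /= (evalZ (V := A) (p := p)).
have := derive_cst (0 : R) t 1 : 'D_1 (fun=> 0 : R) (t : R) = 0.
rewrite -z => <-; rewrite (evalZ (V := A) (p := p)) (evalD (V := A) (p := p)).
apply: etrans (esym dE); rewrite mulrDr; congr (_ + _).
by rewrite addrC; congr (_ + _); exact: mulrC.
Qed.

Section Closure.
Context (D : forall p, A p -> dual A p -> Prop) (mD : maximally_isotropic D).

Lemma line_rel_iso (X Y : vsection (line A)) (xi eta : vsection (line (dual A)))
    p t :
  smooth_section SL X -> smooth_section SL (V := dual (line A)) xi ->
  (forall q, line_rel D q (X q) (xi q)) ->
  (forall q, line_rel D q (Y q) (eta q)) ->
  ev p (dt xi (p, t)) (Y (p, t)) + ev p (eta (p, t)) (dt X (p, t))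
    + ev p (eta (p, t)) (X (p, t)) = 0.
Proof.
move=> sX sxi DX DY.
have := max_isotropic_pairing mD (line_rel_time_derive p t mD sX sxi DX) (DY (p, t)).
rewrite /= !evalZ evalD -mulrDr => /eqP; rewrite mulf_eq0 (negPf (expR_neq0 t))/=.
by move=> /eqP <-; rewrite -addrA; congr (_ + _); rewrite addrC.
Qed.

(** The drift is a combination of e1' - e1 and e2' - e2, where e1 = (e^t X, xi) and
    e2 = (e^t Y, eta) run in D_p. *)
Lemma drift_rel (X : vsection (line A)) (xi : vsection (line (dual A)))
    (Y : vsection (line A)) (eta : vsection (line (dual A))) p t :
  smooth_section SL X -> smooth_section SL (V := dual (line A)) xi ->
  smooth_section SL Y -> smooth_section SL (V := dual (line A)) eta ->
  (forall q, line_rel D q (X q) (xi q)) ->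
  (forall q, line_rel D q (Y q) (eta q)) ->
  @D p (drift_A X xi Y eta p t) (drift_As X xi Y eta p t).
Proof.
move=> sX sxi sY seta DX DY; have lD := max_isotropic_linear mD.
have dX := lD p (-1) _ _ _ _ (DX (p, t)) (line_rel_time_derive p t mD sX sxi DX).
have dY := lD p (-1) _ _ _ _ (DY (p, t)) (line_rel_time_derive p t mD sY seta DY).
have D0 : @D p 0 0.
  by have := lD p (-1) _ _ _ _ dX dX; rewrite !scaleN1r !addNr.
have := lD p (weight X xi p t) _ _ _ _ dY
  (lD p (- weight Y eta p t) _ _ _ _ dX D0).
congr (@D p _ _).
  rewrite /drift_A /= addr0 !scaleN1r !(scalerDr (expR t)) !addKr.
  by rewrite scalerN scaleNr !scalerA !(mulrC (expR t)).
exact: diff_comb.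
Qed.

Lemma courant_drift (X : vsection (line A)) (xi : vsection (line (dual A)))
    (Y : vsection (line A)) (eta : vsection (line (dual A))) p t :
  smooth_section SL X -> smooth_section SL (V := dual (line A)) xi ->
  smooth_section SL Y -> smooth_section SL (V := dual (line A)) eta ->
  (forall q, line_rel (@D) q (X q) (xi q)) ->
  (forall q, line_rel (@D) q (Y q) (eta q)) ->
  (forall b : vsection (line (dual A)),
     smooth_section SL (V := dual (line A)) b ->
     @courant_A R (M * R)%type (line A) bar hat (fun=> 0) X xi Y eta [:: b] (p, t) =
     expR t ^- 2 *
      (courant_A L Ls X0 (exp_slice t X) (slice t xi) (exp_slice t Y) (slice t eta)
         [:: slice t b] p + ev p (b (p, t)) (drift_A X xi Y eta p t))) /\
  (forall B : vsection (line A), smooth_section SL B ->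
     @courant_As R (M * R)%type (line A) bar hat (fun=> 0) X xi Y eta [:: B] (p, t) =
     (expR t)^-1 *
      (courant_As L Ls phi0 (exp_slice t X) (slice t xi) (exp_slice t Y) (slice t eta)
         [:: slice t B] p + ev p (drift_As X xi Y eta p t) (B (p, t)))).
Proof.
move=> sX sxi sY seta DX DY.
have iso1 := line_rel_iso p t sX sxi DX DY.
have iso2 := line_rel_iso p t sY seta DY DX.
split=> [b sb|B sB].
  exact: courant_A_line.
exact: courant_As_line.
Qed.

Lemma exp_slice_lift (X : vsection A) : exp_slice 0 (exp_lift X) = X.
Proof.
by apply: functional_extensionality_dep => p;
  rewrite /exp_slice /slice /exp_lift /= oppr0 expR0 !scale1r.
Qed.

Lemma line_rel_exp_lift (X : vsection A) (xi : vsection (dual A)) :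
  (forall p, @D p (X p) (xi p)) ->
  forall q, line_rel (@D) q (exp_lift X q) (const_lift xi q).
Proof.
by move=> DX [p t]; rewrite /line_rel /exp_lift /= scalerA expRN mulfV ?expR_neq0// scale1r.
Qed.

(** Both brackets differ by scaling and by the drift, a section of D.  From M * R to
    M, lift the sections and read the result in t = 0; from M to M * R, take the
    brackets at each frozen time, put together by choice: the witnesses need not
    depend smoothly on t. *)
Lemma courant_closed_line :
  (forall X xi Y eta,
     smooth_section SL X -> smooth_section SL (V := dual (line A)) xi ->
     smooth_section SL Y -> smooth_section SL (V := dual (line A)) eta ->
     (forall q, line_rel (@D) q (X q) (xi q)) ->
     (forall q, line_rel (@D) q (Y q) (eta q)) ->
     exists (Z : vsection (line A)) (zeta : vsection (dual (line A))),
       @is_courant R (M * R)%type (n + 1) SL (line A) bar hat (fun=> 0) (fun=> 0)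
         X xi Y eta Z zeta /\
       forall q, line_rel (@D) q (Z q) (zeta q)) <->
  (forall X xi Y eta,
     smooth_section S X -> smooth_section S (V := dual A) xi ->
     smooth_section S Y -> smooth_section S (V := dual A) eta ->
     (forall p, @D p (X p) (xi p)) -> (forall p, @D p (Y p) (eta p)) ->
     exists (Z : vsection A) (zeta : vsection (dual A)),
       is_courant S L Ls phi0 X0 X xi Y eta Z zeta /\
       forall p, @D p (Z p) (zeta p)).
Proof.
have lD := max_isotropic_linear mD.
split=> H.
- move=> X xi Y eta sX sxi sY seta DX DY.
  have sX' := smooth_exp_lift mS fA sX; have sY' := smooth_exp_lift mS fA sY.
  have sd := smooth_dual_lift.
  have sxi' := sd _ sxi; have seta' := sd _ seta.
  have DX' := line_rel_exp_lift DX; have DY' := line_rel_exp_lift DY.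
  have [Z [zeta [[ZE zetaE] DZ]]] := H _ _ _ _ sX' sxi' sY' seta' DX' DY'.
  pose dA := drift_A (exp_lift X) (const_lift xi) (exp_lift Y) (const_lift eta).
  pose dAs := drift_As (exp_lift X) (const_lift xi) (exp_lift Y) (const_lift eta).
  have dE p := courant_drift p 0 sX' sxi' sY' seta' DX' DY'.
  exists (fun p => (Z (p, 0) : A p) - dA p 0),
    (fun p => (zeta (p, 0) : dual A p) - dAs p 0).
  split; first split.
  + move=> b sb p; have [+ _] := dE p; move=> /(_ _ (sd _ sb)).
    rewrite -(ZE _ (sd _ sb)) expR0 expr1n invr1 mul1r !exp_slice_lift => E.
    by rewrite evalB E addrK.
  + move=> B sB p; have [_ +] := dE p; move=> /(_ _ (smooth_const_lift sB)).
    rewrite -(zetaE _ (smooth_const_lift sB)) expR0 invr1 mul1r !exp_slice_lift => E.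
    by rewrite dualB E addrK.
  + move=> p; have := lD p (-1) _ _ _ _ (drift_rel p 0 sX' sxi' sY' seta' DX' DY')
      (DZ (p, 0)).
    by rewrite /= expR0 scale1r !scaleN1r ![- _ + _]addrC.
- move=> X xi Y eta sX sxi sY seta DX DY.
  have sd := smooth_dual_slice.
  pose P t (z : vsection A * vsection (dual A)) :=
    is_courant S L Ls phi0 X0 (exp_slice t X) (slice (V := dual A) t xi)
        (exp_slice t Y) (slice (V := dual A) t eta) z.1 z.2 /\
      forall p, @D p (z.1 p) (z.2 p).
  have /choice[f fP] : forall t, exists z, P t z.
    move=> t.
    have [Z [zeta HZ]] := H _ _ _ _ (smooth_exp_slice t sX) (sd t _ sxi)
      (smooth_exp_slice t sY) (sd t _ seta) (fun p => DX (p, t))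
      (fun p => DY (p, t)).
    by exists (Z, zeta).
  exists (fun q => expR q.2 ^- 2 *:
      (((f q.2).1 q.1 : A q.1) + drift_A X xi Y eta q.1 q.2)),
    (fun q => (expR q.2)^-1 *:
      (((f q.2).2 q.1 : dual A q.1) + drift_As X xi Y eta q.1 q.2)).
  split; first split.
  + move=> b sb [p t]; have [+ _] := courant_drift p t sX sxi sY seta DX DY.
    move=> /(_ _ sb) ->; have [[ZE _] _] := fP t.
    by rewrite -(ZE _ (sd t _ sb)) (evalZ (V := A) (p := p)) (evalD (V := A) (p := p)).
  + move=> B sB [p t]; have [_ +] := courant_drift p t sX sxi sY seta DX DY.
    move=> /(_ _ sB) ->; have [[_ zetaE] _] := fP t.
    rewrite -(zetaE _ (smooth_slice t sB)).
    apply: etrans (dualZ (V := A) (p := p) _ _ _) _; congr (_ * _).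
    exact: dualD.
  + move=> [p t]; have [_ DZ] := fP t.
    have D0 : @D p 0 0.
      by have := lD p (-1) _ _ _ _ (DZ p) (DZ p); rewrite !scaleN1r !addNr.
    have D1 := lD p 1 _ _ _ _ (DZ p) (drift_rel p t sX sxi sY seta DX DY).
    have := lD p (expR t)^-1 _ _ _ _ D1 D0.
    rewrite /line_rel /= !addr0 !scale1r scalerA expr2 invfM mulrA mulfV ?mul1r//.
    exact: expR_neq0.
Qed.

End Closure.

Lemma dirac_line D :
  @Defs.dirac R (M * R)%type (n + 1) SL (line A) bar hat (fun=> 0) (fun=> 0) (line_rel D)
  <-> Defs.dirac S L Ls phi0 X0 D.
Proof.
split=> -[sD mD cD].
  have mD' := (maximally_isotropic_line D).1 mD.
  by split=> //; [exact/subbundle_line|exact/(courant_closed_line mD')].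
split; [exact/subbundle_line|exact/maximally_isotropic_line|].
exact/(courant_closed_line mD).
Qed.

(** * Nijenhuis relations under rescaling *)

(** For N = [NLL D D'] this is, by conversion, the relation of [line_rel D] and
    [line_rel D']. *)
Definition line_endorel (N : forall p, A p -> A p -> Prop) :
    forall q, line A q -> line A q -> Prop :=
  fun q x y => N q.1 (expR q.2 *: x) (expR q.2 *: y).

Arguments line_endorel N q x y : clear implicits.

Implicit Type N : forall p, A p -> A p -> Prop.

(** The scaling acts on both members of N by the same factor, which cancels in the
    linear equation <a, v> = <b, u> defining the dual relation. *)
Lemma dual_rel_endo_line N p t (a b : dual A p) :
  dual_rel (line_endorel N) (p := (p, t)) a b <-> dual_rel N a b.
Proof.
have e0 := expR_neq0 t; split=> H u v Nuv; last first.
  apply: (mulfI e0); rewrite -[LHS](evalZ b) -[RHS](evalZ a).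
  exact: H.
apply: (mulfI (invr_neq0 e0)); rewrite -[LHS](evalZ b) -[RHS](evalZ a).
by apply: H; rewrite /line_endorel/= !scalerA mulfV// !scale1r.
Qed.

(** Covectors a and b are kept fixed; <b, X> = <a, Y> then holds for all times and
    may be differentiated. *)
Lemma dual_rel_time_derive N (X Y : vsection (line A)) p t (a b : dual A p) :
  smooth_section SL X -> smooth_section SL Y ->
  (forall q, line_endorel N q (X q) (Y q)) -> dual_rel N a b ->
  ev p b (dt X (p, t)) = ev p a (dt Y (p, t)).
Proof.
move=> sX sY NXY ab.
have [_ <-] := eval_curve_derive (V := A) (p := p) b
  (smooth_curve_derivable mS (p := p) (t := t) fA sX).
have [_ <-] := eval_curve_derive (V := A) (p := p) a
  (smooth_curve_derivable mS (p := p) (t := t) fA sY).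
congr ('D_1 _ t); apply: funext => s.
exact: ((dual_rel_endo_line N s a b).2 ab _ _ (NXY (p, s))).
Qed.

(** By [dual_rel_time_derive] the terms in d/dt cancel in pairs, grouped by the
    factors <phi0, X_i> and <phi0, Y_i>. *)
Lemma torsion_line N (X1 Y1 X2 Y2 : vsection (line A)) p t (a b c : dual A p) :
  smooth_section SL X1 -> smooth_section SL Y1 ->
  smooth_section SL X2 -> smooth_section SL Y2 ->
  (forall q, line_endorel N q (X1 q) (Y1 q)) ->
  (forall q, line_endorel N q (X2 q) (Y2 q)) ->
  dual_rel N a b -> dual_rel N b c ->
  ev p a (br bar Y1 Y2 (p, t))
  - ev p b (br bar Y1 X2 (p, t) + br bar X1 Y2 (p, t))
  + ev p c (br bar X1 X2 (p, t)) =
  expR t ^- 2 *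
    (ev p a (br L (exp_slice t Y1) (exp_slice t Y2) p)
     - ev p b (br L (exp_slice t Y1) (exp_slice t X2) p
               + br L (exp_slice t X1) (exp_slice t Y2) p)
     + ev p c (br L (exp_slice t X1) (exp_slice t X2) p)).
Proof.
move=> sX1 sY1 sX2 sY2 N1 N2 ab bc.
rewrite [ev p b (br _ _ _ _ + _)]evalD (evalD b).
rewrite !(br_barE)//.
rewrite (dual_rel_time_derive t sX1 sY1 N1 ab) (dual_rel_time_derive t sX2 sY2 N2 ab).
rewrite (dual_rel_time_derive t sX1 sY1 N1 bc) (dual_rel_time_derive t sX2 sY2 N2 bc).
rewrite -exprVn.
move: (expR t)^-1 => e.
by abstract_reals; ring.
Qed.

Lemma nijenhuis_line N :
  @nijenhuis R (M * R)%type (n + 1) SL (line A) bar (line_endorel N) <->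
  nijenhuis S L N.
Proof.
split=> H X1 Y1 X2 Y2 a b c sX1 sY1 sX2 sY2 sa sb sc N1 N2 ab bc.
- have sl := smooth_exp_lift mS fA.
  have sd := smooth_dual_lift.
  have Nl (X Y : vsection A) : (forall p, N p (X p) (Y p)) ->
      forall q, line_endorel N q (exp_lift X q) (exp_lift Y q).
    move=> NXY [p t]; rewrite /line_endorel /exp_lift /= !scalerA expRN mulfV ?expR_neq0//.
    by rewrite !scale1r.
  move=> p; have := torsion_line 0 (sl _ sX1) (sl _ sY1) (sl _ sX2)
    (sl _ sY2) (Nl _ _ N1) (Nl _ _ N2) (ab p) (bc p).
  rewrite !exp_slice_lift expR0 expr1n invr1 mul1r => <-.
  have dl (d d' : vsection (dual A)) : (forall q, dual_rel N (d q) (d' q)) ->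
      forall q, dual_rel (line_endorel N) (p := q) (d q.1) (d' q.1).
    by move=> dd' [q s]; exact/dual_rel_endo_line.
  exact: (H _ _ _ _ (const_lift a) (const_lift b) (const_lift c) (sl _ sX1)
    (sl _ sY1) (sl _ sX2) (sl _ sY2) (sd _ sa) (sd _ sb) (sd _ sc)
    (Nl _ _ N1) (Nl _ _ N2) (dl _ _ ab) (dl _ _ bc) (p, 0)).
- move=> [p t].
  have ab' q : dual_rel N (a (q, t)) (b (q, t)) by apply/dual_rel_endo_line; exact: ab.
  have bc' q : dual_rel N (b (q, t)) (c (q, t)) by apply/dual_rel_endo_line; exact: bc.
  have sd := smooth_dual_slice t.
  have sl := smooth_exp_slice t.
  apply: etrans (torsion_line t sX1 sY1 sX2 sY2 N1 N2 (ab' p) (bc' p)) _.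
  rewrite (H _ _ _ _ _ _ _ (sl _ sX1) (sl _ sY1) (sl _ sX2) (sl _ sY2)
    (sd _ sa) (sd _ sb) (sd _ sc) (fun q => N1 (q, t)) (fun q => N2 (q, t))
    ab' bc').
  by rewrite mulr0.
Qed.

(** * Graphs of bivectors and two-forms *)

Lemma graph_sharp_line (pi : tensor (dual A)) :
  graph_sharp (A := line A) (tilde_pi pi) = line_rel (graph_sharp pi).
Proof.
apply: functional_extensionality_dep => -[p t].
apply: funext => x; apply: funext => xi; rewrite /graph_sharp /line_rel /tilde_pi /=.
apply: propext; split=> H eta; have := H eta.
  by rewrite evalZ => ->; rewrite expRN mulVKf ?expR_neq0.
by rewrite evalZ => <-; rewrite expRN mulKf ?expR_neq0.
Qed.

Lemma graph_flat_line (om : tensor A) : smooth_tensor S 2 om ->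
  graph_flat (A := line A) (tilde_om om) = line_rel (graph_flat om).
Proof.
case=> _ lin _ _; apply: functional_extensionality_dep => -[p t].
apply: funext => x; apply: funext => xi; rewrite /graph_flat /line_rel /tilde_om /=.
suff E y : om p [:: expR t *: x; y] = expR t * om p [:: x; y].
  by apply: propext; split=> H y; rewrite H E.
have := lin p [::] [:: y] (expR t - 1) x x; rewrite /= scalerBl scale1r subrK => ->.
by rewrite mulrBl mul1r subrK.
Qed.

Lemma dirac_pair_line D D' :
  @lie_dirac_pair R (M * R)%type (n + 1) SL (line A) bar hat
    (line_rel D) (line_rel D') <->
  dirac_pair S L Ls phi0 X0 D D'.
Proof.
by split=> -[dD dD' nN]; split;
  [exact/dirac_line|exact/dirac_line|exact/nijenhuis_line
  |exact/dirac_line|exact/dirac_line|exact/(nijenhuis_line (NLL D D'))].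
Qed.

End Poissonization.

Theorem theorem3p2 (R : realType) (M : topologicalType) (n : nat)
    (S : set (chart R M n)) (A : vbundle R M)
    (L : algebroid A) (Ls : algebroid (dual A))
    (phi0 : vsection (dual A)) (X0 : vsection A)
    (pi1 pi2 : tensor (dual A)) (om1 om2 : tensor A) :
  manifold S -> vector_bundle S A ->
  jacobi_bialgebroid S L Ls phi0 X0 ->
  smooth_tensor S 2 pi1 -> smooth_tensor S 2 pi2 ->
  smooth_tensor S 2 om1 -> smooth_tensor S 2 om2 ->
  maurer_cartan S L Ls phi0 X0 pi1 -> maurer_cartan S L Ls phi0 X0 pi2 ->
  co_maurer_cartan S L Ls phi0 X0 om1 -> co_maurer_cartan S L Ls phi0 X0 om2 ->
  let bi_pair := dirac_pair S L Ls phi0 X0 in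
  let tilde_pair :=
    @lie_dirac_pair R (M * R)%type (n + 1) (line_atlas S) (line A)
      (bar_algebroid L phi0) (hat_algebroid Ls X0) in
  [/\ tilde_pair (graph_sharp (tilde_pi pi1)) (graph_sharp (tilde_pi pi2)) <->
        bi_pair (graph_sharp pi1) (graph_sharp pi2),
      tilde_pair (graph_sharp (tilde_pi pi1)) (graph_flat (tilde_om om2)) <->
        bi_pair (graph_sharp pi1) (graph_flat om2) &
      tilde_pair (graph_flat (tilde_om om1)) (graph_flat (tilde_om om2)) <->
        bi_pair (graph_flat om1) (graph_flat om2)].
Proof.
move=> mS /vector_bundle_framed fA [[lL _ _] [lLs _ _] _ _].
move=> _ _ som1 som2 _ _ _ _ bi_pair tilde_pair.
rewrite !graph_sharp_line (graph_flat_line som1) (graph_flat_line som2).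
by split; exact: dirac_pair_line.
Qed.
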